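(* Let $h\in M_n(\mathbb C)$ be a complex Hadamard matrix, with associated quantum permutation algebra $A=A(h)$. The following are equivalent: (1) $A$ is commutative. (2) $h$ is equivalent to a tensor product of Fourier matrices.
   Context: A projection in a (unital) $C^*$-algebra is an element $p$ with $p^2=p=p^*$; projections $p,q$ are orthogonal if $pq=0$; a partition of unity is a set of pairwise orthogonal projections summing to $1$. A magic unitary is a square matrix $u\in M_n(A)$ over a $C^*$-algebra $A$, all of whose rows and columns are partitions of unity in $A$. $A(S_n)$ is the universal $C^*$-algebra generated by $n^2$ elements $x_{ij}$ with the relations making $(x_{ij})$ a magic unitary; it carries the morphisms $\Delta(x_{ij})=\sum_k x_{ik}\otimes x_{kj}$, $\varepsilon(x_{ij})=\delta_{ij}$, $S(x_{ij})=x_{ji}$. A quantum permutation algebra is a $C^*$-algebra $A$ given with a magic unitary $u\in M_n(A)$ whose entries generate $A$ and such that $\Delta(u_{ij})=\sum_k u_{ik}\otimes u_{kj}$, $\varepsilon(u_{ij})=\delta_{ij}$, $S(u_{ij})=u_{ji}$ define morphisms of $C^*$-algebras $A\to A\otimes A$, $A\to\mathbb C$, $A\to A^{op}$. For a representation $\pi:A(S_n)\to B(H)$, $A_\pi$ denotes the smallest quantum permutation algebra realizing a factorization of $\pi$: there is a factorization $A(S_n)\to A_\pi\to B(H)$ of $\pi$ with first map $x_{ij}\mapsto u_{ij}$, and for every quantum permutation algebra $(A',u')$ with a factorization $A(S_n)\to A'\to B(H)$ of $\pi$, $x_{ij}\mapsto u'_{ij}$, there is a surjective morphism $A'\to A_\pi$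 with $u'_{ij}\mapsto u_{ij}$. It exists and is unique up to isomorphism. A (complex) Hadamard matrix is $h\in M_n(\mathbb C)$ with all entries of modulus $1$ and with pairwise orthogonal rows. Let $h_1,\ldots,h_n$ be its rows, viewed as invertible elements of the algebra $\mathbb C^n$ with entrywise product. The rank one orthogonal projections $P_{ij}$ onto the lines $\mathbb C\,(h_j/h_i)$ form a magic unitary over $M_n(\mathbb C)$; let $\pi_h:A(S_n)\to M_n(\mathbb C)$ be the representation $x_{ij}\mapsto P_{ij}$. Then $A(h):=A_{\pi_h}$. Two Hadamard matrices are equivalent if one can pass from one to the other by permutations of rows and columns, and by multiplications of rows and columns by complex numbers of modulus $1$. The Fourier matrix of order $N$ is $F_{ij}=w^{ij}$, $i,j\in\{1,\ldots,N\}$, with $w=e^{2\pi i/N}$. The tensor product of $h\in M_n(\mathbb C)$ and $k\in M_m(\mathbb C)$ is $h\otimes k\in M_{nm}(\mathbb C)$, $(h\otimes k)_{ia,jb}=h_{ij}k_{ab}$, with double indices ordered lexicographically; a tensor product of Fourier matrices may have any number (at least one) of factors, of any orders. *)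

(* Defs.v *)
Set Warnings "-notation-overridden,-ambiguous-paths,-notation-incompatible-prefix,-redundant-canonical-projection".
From HB Require Import structures.
From mathcomp Require Import all_boot all_order all_algebra all_fingroup.
From mathcomp Require Import complex mxtens.
From mathcomp Require Import all_classical all_reals all_analysis.

Set Implicit Arguments.
Unset Strict Implicit.
Unset Printing Implicit Defensive.

Import Order.TTheory GRing.Theory Num.Theory.
Import numFieldNormedType.Exports.

Local Open Scope classical_set_scope.
Local Open Scope complex_scope.
Local Open Scope ring_scope.

HB.mixin Record isStarAlgebra (R : realType) A of GRing.Algebra R[i] A := {
  star : A -> A;
  starK : involutive star;
  starD : {morph star : a b / a + b};
  starZ : forall (c : R[i]) (a : A), star (c *: a) = c^* *: star a;
  starM : forall a b : A, star (a * b) = star b * star a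
}.

#[short(type="starAlgType")]
HB.structure Definition StarAlgebra (R : realType) :=
  {A of isStarAlgebra R A & GRing.Algebra R[i] A}.

(* The norm is a field of its own: HB admits no join of the library's rings
   with its normed modules below numDomainType. *)
HB.mixin Record isCStar (R : realType) A of StarAlgebra R A := {
  cnorm : A -> R;
  cnorm0_eq0 : forall a : A, cnorm a = 0 -> a = 0;
  ler_cnormD : forall a b : A, cnorm (a + b) <= cnorm a + cnorm b;
  cnormZ : forall (c : R[i]) (a : A), cnorm (c *: a) = complex.Re `|c| * cnorm a;
  ler_cnormM : forall a b : A, cnorm (a * b) <= cnorm a * cnorm b;
  cnorm_star : forall a : A, cnorm (star a * a) = cnorm a ^+ 2;
  cnorm_complete : forall s : nat -> A,
    (forall e : R, 0 < e -> exists N, forall m n, (N <= m)%N -> (N <= n)%N ->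
       cnorm (s m - s n) < e) ->
    exists l : A, forall e : R, 0 < e -> exists N, forall n, (N <= n)%N ->
       cnorm (s n - l) < e
}.

#[short(type="cstarAlgType")]
HB.structure Definition CStarAlgebra (R : realType) :=
  {A of isCStar R A & StarAlgebra R A}.

(* Morphisms of C*-algebras are the unital *-homomorphisms; such maps are
   automatically norm decreasing. *)
HB.mixin Record isStarMorphism (R : realType) (A B : starAlgType R)
    (f : A -> B) := {
  morph_star : {morph f : a / star a >-> star a}
}.

#[short(type="starHom")]
HB.structure Definition StarMorphism (R : realType) (A B : starAlgType R) :=
  {f of isStarMorphism R A B f & @GRing.LRMorphism R[i] A B *:%R f}.

Section ComplexNumbers.
Variable R : realType.

Let conjcZ (c a : R[i]^o) : (c *: a)^* = c^* *: (a^* : R[i]^o).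
Proof. exact: rmorphM. Qed.

Let conjcM (a b : R[i]^o) : (a * b)^* = (b^* : R[i]^o) * a^*.
Proof. by rewrite [LHS]rmorphM mulrC. Qed.

HB.instance Definition _ := @isStarAlgebra.Build R R[i]^o
  (@conjc R) (@conjcK R) (rmorphD (@conjc R)) conjcZ conjcM.

End ComplexNumbers.

Section MatrixAlgebra.
Variables (R : realType) (n : nat).
Implicit Types M N : 'M[R[i]]_n.+1.

Definition adjmx M : 'M[R[i]]_n.+1 := map_mx (@conjc R) M^T.

Let adjmxK : involutive adjmx.
Proof. by move=> M; apply/matrixP => i j; rewrite !mxE conjcK. Qed.

Let adjmxD : {morph adjmx : M N / M + N}.
Proof. by move=> M N; rewrite /adjmx !raddfD. Qed.

Let adjmxZ (c : R[i]) M : adjmx (c *: M) = c^* *: adjmx M.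
Proof. by apply/matrixP => i j; rewrite !mxE rmorphM. Qed.

Let adjmxM M N : adjmx (M * N) = adjmx N * adjmx M.
Proof. by rewrite /adjmx trmx_mul map_mxM. Qed.

HB.instance Definition _ := @isStarAlgebra.Build R 'M[R[i]]_n.+1
  adjmx adjmxK adjmxD adjmxZ adjmxM.

End MatrixAlgebra.

(* The opposite *-algebra: the same *-vector space, with product b * a. *)
Section Opposite.
Variables (R : realType) (A : starAlgType R).

HB.instance Definition _ := GRing.Lmodule.copy A^c A.

Let convAl (c : R[i]) (a b : A^c) : c *: (a * b) = (c *: a : A^c) * b.
Proof. exact: (scalerAr c (b : A) (a : A)). Qed.

HB.instance Definition _ := GRing.Lmodule_isLalgebra.Build R[i] A^c convAl.

Let convAr (c : R[i]) (a b : A^c) : c *: (a * b) = a * (c *: b : A^c).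
Proof. exact: (scalerAl c (b : A) (a : A)). Qed.

HB.instance Definition _ := GRing.Lalgebra_isAlgebra.Build R[i] A^c convAr.

Let convM (a b : A^c) : (star (a * b : A) : A^c) = (star (b : A) : A^c) * (star (a : A) : A^c).
Proof. exact: (@starM R A b a). Qed.

HB.instance Definition _ := @isStarAlgebra.Build R A^c
  (@star R A) (@starK R A) (@starD R A) (@starZ R A) convM.

End Opposite.

HB.mixin Record isHilbert (R : realType) H of CompleteNormedModule R[i] H := {
  inner : {dot H for (@conjc R)};
  norm_inner : forall x : H, `|x| ^+ 2 = inner x x
}.

#[short(type="hilbertType")]
HB.structure Definition Hilbert (R : realType) :=
  {H of isHilbert R H & CompleteNormedModule R[i] H}.

Section CStar.
Variable R : realType.
Local Notation C := R[i].

Definition linear_span (V : lmodType C) (S : set V) : set V :=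
  [set v | exists (m : nat) (c : 'I_m -> C) (s : 'I_m -> V),
     (forall k, S (s k)) /\ v = \sum_k c k *: s k].

Definition cclosure (A : cstarAlgType R) (S : set A) : set A :=
  [set a | forall e : R, 0 < e -> exists2 b, S b & cnorm (a - b) < e].

Definition faithful_rep (A : cstarAlgType R) (H : hilbertType R)
    (rho : A -> H -> H) : Prop :=
  [/\ (forall a, linear (rho a) /\ continuous (rho a)),
      (forall xi, linear (rho^~ xi)),
      (rho 1 =1 id /\ forall a b xi, rho (a * b) xi = rho a (rho b xi)),
      (forall a xi eta, inner (rho a xi) eta = inner xi (rho (star a) eta)) &
      forall a, (forall xi, rho a xi = 0) -> a = 0].

(* L is the Hilbert space tensor product of H and K, with elementary tensors
   t xi eta. *)
Definition hilbert_tensor (H K L : hilbertType R) (t : H -> K -> L) : Prop :=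
  [/\ (forall eta, linear (t^~ eta)), (forall xi, linear (t xi)),
      (forall xi eta xi' eta',
         inner (t xi eta) (t xi' eta') = inner xi xi' * inner eta eta') &
      closure (linear_span [set z | exists xi eta, z = t xi eta]) = setT].

(* T is the (spatial, i.e. minimal) tensor product of the C*-algebras A and B,
   with elementary tensors tau a b: for faithful representations of A on H and
   of B on K, it is the closed linear span, inside the bounded operators of the
   Hilbert space tensor product L of H and K, of the operators a (x) b.  The
   choice of the faithful representations is immaterial, and sigma, being
   faithful, is isometric. *)
Definition cstar_tensor (A B T : cstarAlgType R) (tau : A -> B -> T) : Prop :=
  cclosure (linear_span [set z | exists a b, z = tau a b]) = setT /\
  exists (H K L : hilbertType R) (t : H -> K -> L)
    (rho : A -> H -> H) (rho' : B -> K -> K) (sigma : T -> L -> L),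
    [/\ hilbert_tensor t, faithful_rep rho, faithful_rep rho',
        faithful_rep sigma &
        forall a b xi eta,
          sigma (tau a b) (t xi eta) = t (rho a xi) (rho' b eta)].

Section Magic.
Variable n : nat.

Definition is_projection (A : starAlgType R) (p : A) : Prop :=
  p * p = p /\ star p = p.

Definition partition_of_unity (A : starAlgType R) (p : 'I_n -> A) : Prop :=
  [/\ forall k, is_projection (p k), forall k l, k != l -> p k * p l = 0 &
      \sum_k p k = 1].

Definition magic_unitary (A : starAlgType R) (u : 'M[A]_n) : Prop :=
  (forall i, partition_of_unity (u i)) /\
  (forall j, partition_of_unity (u^~ j)).

Definition closed_star_subalgebra (A : cstarAlgType R) (B : set A) : Prop :=
  [/\ cclosure B `<=` B, B 1, (forall (c : C) a b, B a -> B b -> B (c *: a + b)),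
      (forall a b, B a -> B b -> B (a * b)) & forall a, B a -> B (star a)].

Definition entries_generate (A : cstarAlgType R) (u : 'M[A]_n) : Prop :=
  forall B : set A, closed_star_subalgebra B -> (forall i j, B (u i j)) ->
    B = setT.

(* (AS, x) is the algebra A(S_n) with its generators x_ij. *)
Definition universal_magic (AS : cstarAlgType R) (x : 'M[AS]_n) : Prop :=
  [/\ magic_unitary x, entries_generate x &
      forall (B : cstarAlgType R) (v : 'M[B]_n), magic_unitary v ->
        exists f : starHom AS B, forall i j, f (x i j) = v i j].

Definition quantum_permutation_algebra (A : cstarAlgType R) (u : 'M[A]_n)
    : Prop :=
  [/\ magic_unitary u,
      entries_generate u,
      (exists (AA : cstarAlgType R) (tau : A -> A -> AA), cstar_tensor tau /\
         exists Delta : starHom A AA,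
           forall i j, Delta (u i j) = \sum_k tau (u i k) (u k j)),
      (exists eps : starHom A C^o, forall i j, eps (u i j) = (i == j)%:R) &
      (exists S : starHom A A^c, forall i j, S (u i j) = u j i)].

Section Factorization.
Variables (AS : cstarAlgType R) (x : 'M[AS]_n).
Variables (B : starAlgType R) (pi : starHom AS B).

Definition factors_through (A : cstarAlgType R) (u : 'M[A]_n) : Prop :=
  exists (f : starHom AS A) (g : starHom A B),
    (forall i j, f (x i j) = u i j) /\ (forall a, pi a = g (f a)).

(* (A, u) is the algebra A_pi. *)
Definition minimal_factorization (A : cstarAlgType R) (u : 'M[A]_n) : Prop :=
  [/\ quantum_permutation_algebra u, factors_through u &
      forall (A' : cstarAlgType R) (u' : 'M[A']_n),
        quantum_permutation_algebra u' -> factors_through u' ->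
        exists f : starHom A' A,
          (forall b, exists a, f a = b) /\
          (forall i j, f (u' i j) = u i j)].

End Factorization.
End Magic.

Definition hadamard n (h : 'M[C]_n) : Prop :=
  (forall i j, `|h i j| = 1) /\
  (forall i i', i != i' -> \sum_k h i k * (h i' k)^* = 0).

(* The orthogonal projection v v^* / |v|^2 onto the line spanned by v. *)
Definition line_projection n (v : 'I_n -> C) : 'M[C]_n :=
  (\sum_k `|v k| ^+ 2)^-1 *: \matrix_(a, b) (v a * (v b)^*).

Definition hadamard_projection n (h : 'M[C]_n) (i j : 'I_n) : 'M[C]_n :=
  line_projection (fun k => h j k / h i k).

(* (A, u) is the quantum permutation algebra A(h). *)
Definition hadamard_algebra n (h : 'M[C]_n.+1)
    (A : cstarAlgType R) (u : 'M[A]_n.+1) : Prop :=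
  exists (AS : cstarAlgType R) (x : 'M[AS]_n.+1)
    (pi : starHom AS 'M[C]_n.+1),
    [/\ universal_magic x,
        forall i j, pi (x i j) = hadamard_projection h i j &
        minimal_factorization x pi u].

Definition hadamard_equiv n (h k : 'M[C]_n) : Prop :=
  exists (s t : 'S_n) (a b : 'I_n -> C),
    [/\ forall i, `|a i| = 1, forall j, `|b j| = 1 &
        forall i j, k i j = a i * b j * h (s i) (t j)].

(* Rows and columns are numbered from 1, whence the successors. *)
Definition fourier N : 'M[C]_N :=
  let w := cos (2 * pi / N%:R) +i* sin (2 * pi / N%:R) : C in
  \matrix_(i, j) w ^+ (i.+1 * j.+1).

Inductive fourier_tensor : forall n, 'M[C]_n -> Prop :=
| Fourier_single N : (0 < N)%N -> fourier_tensor (fourier N)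
| Fourier_tens m n (h : 'M[C]_m) (k : 'M[C]_n) :
    fourier_tensor h -> fourier_tensor k -> fourier_tensor (h *t k).

End CStar.

(* Main.v *)
From HB Require Import structures.
Require Import Defs.
From mathcomp Require Import all_boot all_order all_algebra all_fingroup.
From mathcomp Require Import all_solvable.
From mathcomp Require Import complex mxtens.
From mathcomp Require Import all_classical all_reals all_analysis.
From mathcomp Require Import ring lra.

(** The entry P_ij of the magic unitary attached to h is the projection onto the
    line of the ratio h_j / h_i of two rows.  Both conditions of the theorem are
    equivalent to a property of these ratios alone, [ratio_dichotomy]: any two of
    them are proportional or orthogonal, that is, any two P_ij are equal or have
    product zero.

    Suppose that A is commutative.  The representation factors through A, so the
    P_ij commute, and commuting projections of rank one are equal or orthogonal.
    The dichotomy is invariant under equivalence, so the first row and the first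
    column of h may be assumed constant equal to 1.  The rows are an orthogonal
    basis, so a ratio of rows cannot be orthogonal to all rows, and must then be a
    row: the rows are a group for the entrywise product ([dephased_mul]).  The n
    columns are distinct characters of this abelian group of order n, hence all
    of its characters.  By the structure theorem of finite abelian groups, a
    character table of such a group is a tensor product of Fourier matrices
    ([abelian_characters]).

    Conversely, the ratios of rows of a Fourier matrix are characters of a cyclic
    group, so the dichotomy holds for it, and it is inherited by tensor products
    and by equivalent matrices.  By minimality A is a quotient of every quantum
    permutation algebra through which the representation factors, so it suffices
    to find one which is commutative; the algebra C(S_n) of functions on the
    symmetric group will do.  By the dichotomy all rows of the matrix P list the
    same projections in various orders, so that each P_0k determines the
    permutation s_k with P_(i, s_k(i)) = P_0k for all i; then
    f |-> sum_k f(s_k) P_0k maps the coordinate function (i, j) to P_ij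
    ([atomic_magic_hom]).

    This factors the representation on the generators of A(S_n), and on all of
    A(S_n) because morphisms from a C*-algebra to matrices are continuous
    ([starhom_entry_le]), a consequence of the convergence of the Neumann series.
    It remains to see C(S_n) as a quantum permutation algebra ([perm_coord_qpa]).
    The coproduct takes values in C(S_n x S_n), which is the spatial tensor
    product as witnessed by multiplication operators on the Hilbert spaces of
    square summable functions. *)

Set Implicit Arguments.
Unset Strict Implicit.
Unset Printing Implicit Defensive.
Import Order.TTheory GRing.Theory Num.Theory.
Local Open Scope complex_scope.
Local Open Scope ring_scope.

(** * Ratios of rows and their projections *)

Section Ratios.
Variable R : realType.
Local Notation C := R[i].

Lemma mulcJ1 (z : C) : `|z| = 1 -> z * z^* = 1.
Proof. by move=> z1; rewrite -normCK z1 expr1n. Qed.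

Lemma unimod_neq0 (z : C) : `|z| = 1 -> z != 0.
Proof. by move=> z1; rewrite -normr_eq0 z1 oner_eq0. Qed.

Lemma unimodV (z : C) : `|z| = 1 -> z^-1 = z^*.
Proof.
by move=> z1; apply: (mulfI (unimod_neq0 z1)); rewrite mulcJ1 // divff ?unimod_neq0.
Qed.

Definition unimodular (n : nat) (h : 'M[C]_n) := forall i j, `|h i j| = 1.

Definition row_ratio (n : nat) (h : 'M[C]_n) (i j : 'I_n) : 'I_n -> C :=
  fun a => h j a / h i a.

Definition inner_sum (n : nat) (v w : 'I_n -> C) : C := \sum_a v a * (w a)^*.

Definition proportional (n : nat) (v w : 'I_n -> C) :=
  exists2 c : C, `|c| = 1 & forall a, v a = c * w a.

(** The property of [h] through which both implications pass.  For unimodular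
    [h] it says that any two of the projections attached to [h] are equal or
    have product zero. *)
Definition ratio_dichotomy (n : nat) (h : 'M[C]_n) :=
  forall i j i' j', proportional (row_ratio h i j) (row_ratio h i' j') \/
    inner_sum (row_ratio h i j) (row_ratio h i' j') = 0.

Lemma row_ratio_unimod (n : nat) (h : 'M[C]_n) i j a :
  unimodular h -> `|row_ratio h i j a| = 1.
Proof. by move=> h1; rewrite /row_ratio normf_div !h1 divr1. Qed.

Lemma line_projectionE (n : nat) (v : 'I_n -> C) : (forall a, `|v a| = 1) ->
  line_projection v = n%:R^-1 *: \matrix_(a, b) (v a * (v b)^*).
Proof.
move=> v1; rewrite /line_projection; congr (_ ^-1 *: _).
rewrite (eq_bigr (fun=> 1)) => [|k _]; last by rewrite v1 expr1n.
by rewrite sumr_const card_ord.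
Qed.

Lemma line_projectionM (n : nat) (v w : 'I_n.+1 -> C) :
  (forall a, `|v a| = 1) -> (forall a, `|w a| = 1) ->
  line_projection v * line_projection w =
  \matrix_(a, b) ((n.+1%:R ^-2 * (inner_sum v w)^*) * (v a * (w b)^*)).
Proof.
move=> v1 w1; rewrite !line_projectionE // -scalerAl -scalerAr scalerA.
have -> : n.+1%:R ^-2 = n.+1%:R^-1 * n.+1%:R^-1 :> C by rewrite -exprVn expr2.
apply/matrixP => a b; rewrite !mxE -[RHS]mulrA; congr (_ * _).
rewrite /inner_sum rmorph_sum mulr_suml; apply: eq_bigr => k _.
by rewrite !mxE rmorphM /= conjCK; ring.
Qed.

Lemma inner_sumC (n : nat) (v w : 'I_n -> C) : inner_sum w v = (inner_sum v w)^*.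
Proof.
by rewrite /inner_sum rmorph_sum; apply: eq_bigr => a _; rewrite rmorphM /= conjCK mulrC.
Qed.

(** Comparing the entries of the two products gives, for s the inner product of
    v and w, that s^* v_a w_0^* = s w_a v_0^* for all a; unless s = 0, this
    solves for v_a as a constant multiple of w_a. *)
Lemma comm_line_projection (n : nat) (v w : 'I_n.+1 -> C) :
  (forall a, `|v a| = 1) -> (forall a, `|w a| = 1) ->
  line_projection v * line_projection w = line_projection w * line_projection v ->
  proportional v w \/ inner_sum v w = 0.
Proof.
move=> v1 w1; rewrite !line_projectionM // [inner_sum w v]inner_sumC conjCK.
set s := inner_sum v w => /matrixP E.
have [->|s0] := eqVneq s 0; [by right|left].
have v00 := unimod_neq0 (v1 0); have w00 := unimod_neq0 (w1 0).
have sc0 : s^* != 0 by rewrite conjC_eq0.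
exists (s / s^* * (w 0 / v 0)) => [|a].
  by rewrite !(normrM, normfV) norm_conjC !v1 !w1 !(invr1, mulr1) divff ?normr_eq0.
have /eqP := E a 0; rewrite !mxE -!mulrA (inj_eq (mulfI _)); last first.
  by rewrite invr_eq0 expf_neq0 // pnatr_eq0.
rewrite -(unimodV (v1 0)) -(unimodV (w1 0)) => /eqP Ea.
apply: (mulfI sc0); apply: (mulIf (invr_neq0 w00)).
rewrite -mulrA Ea; field.
by rewrite v00 w00 sc0.
Qed.

Lemma comm_hadamard_projection (n : nat) (h : 'M[C]_n.+1) : unimodular h ->
  (forall i j i' j', hadamard_projection h i j * hadamard_projection h i' j' =
                     hadamard_projection h i' j' * hadamard_projection h i j) ->
  ratio_dichotomy h.
Proof.
move=> h1 comm i j i' j'; have r1 x y a := row_ratio_unimod x y a h1.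
exact: comm_line_projection (r1 i j) (r1 i' j') (comm i j i' j').
Qed.

Lemma hadamard_equiv_sym (n : nat) (h k : 'M[C]_n) :
  hadamard_equiv h k -> hadamard_equiv k h.
Proof.
move=> [s [t [a [b [a1 b1 E]]]]].
exists s^-1%g, t^-1%g, (fun i => (a (s^-1%g i))^-1), (fun j => (b (t^-1%g j))^-1).
split=> [i|j|i j]; try by rewrite normfV ?a1 ?b1 invr1.
rewrite E !permKV; have /unimod_neq0 a0 := a1 (s^-1%g i).
by have /unimod_neq0 b0 := b1 (t^-1%g j); field; rewrite a0 b0.
Qed.

Lemma hadamard_equiv_trans (n : nat) (h k l : 'M[C]_n) :
  hadamard_equiv h k -> hadamard_equiv k l -> hadamard_equiv h l.
Proof.
move=> [s [t [a [b [a1 b1 E]]]]] [s' [t' [a' [b' [a1' b1' E']]]]].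
exists (s' * s)%g, (t' * t)%g, (fun i => a' i * a (s' i)), (fun j => b' j * b (t' j)).
split=> [i|j|i j]; rewrite ?normrM ?a1 ?b1 ?a1' ?b1' ?mulr1 //.
by rewrite E' E !permM; ring.
Qed.

Lemma unimodular_equiv (n : nat) (h k : 'M[C]_n) :
  hadamard_equiv h k -> unimodular h -> unimodular k.
Proof.
by move=> [s [t [a [b [a1 b1 E]]]]] h1 i j; rewrite E !normrM a1 b1 h1 !mulr1.
Qed.

Lemma hadamard_hadamard_equiv (n : nat) (h k : 'M[C]_n) :
  hadamard_equiv h k -> hadamard h -> hadamard k.
Proof.
move=> e [h1 ho]; split; first exact: unimodular_equiv e h1.
move: e => [s [t [a [b [a1 b1 E]]]]] i i' ii'.
rewrite (eq_bigr (fun j => a i * (a i')^* * (h (s i) (t j) * (h (s i') (t j))^*))).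
  rewrite -mulr_sumr (reindex_perm (t^-1)%g) /=.
  under eq_bigr do rewrite permKV.
  by rewrite ho ?mulr0 // (inj_eq perm_inj).
move=> j _; rewrite !E !rmorphM /= -[RHS]mul1r -(mulcJ1 (b1 j)); ring.
Qed.

(** Permuting columns only reindexes an inner product, permuting rows only
    reindexes the ratios, a phase on a column cancels in every ratio, and phases
    on rows rescale a ratio by a constant of modulus one. *)
Lemma ratio_dichotomy_equiv (n : nat) (h k : 'M[C]_n) :
  hadamard_equiv h k -> ratio_dichotomy h -> ratio_dichotomy k.
Proof.
move=> [s [t [a [b [a1 b1 E]]]]] Q i j i' j'.
have rE x y z : row_ratio k x y z = a y / a x * row_ratio h (s x) (s y) (t z).
  by rewrite /row_ratio !E -!mulf_div divff ?mulr1 // unimod_neq0.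
case: (Q (s i) (s j) (s i') (s j')) => [[c c1 cE]|o]; [left|right].
  exists (a j / a i * c * (a i' / a j')).
    by rewrite !(normrM, normfV) !a1 c1 !invr1 !mulr1.
  move=> z; rewrite !rE cE.
  by field; rewrite !unimod_neq0.
rewrite /inner_sum.
rewrite (eq_bigr (fun z => (a j / a i * (a j' / a i')^*) *
  (row_ratio h (s i) (s j) (t z) * (row_ratio h (s i') (s j') (t z))^*))); last first.
  by move=> z _; rewrite !rE !rmorphM /=; ring.
rewrite -mulr_sumr (reindex_perm (t^-1)%g) /=.
by under eq_bigr do rewrite permKV; rewrite [X in _ * X]o mulr0.
Qed.

(** A ratio of rows of h (x) k is the elementary tensor of a ratio for h and a
    ratio for k, so that inner products multiply: two ratios are orthogonal as
    soon as one pair of factors is. *)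
Lemma ratio_dichotomy_tens (m n : nat) (h : 'M[C]_m) (k : 'M[C]_n) :
  ratio_dichotomy h -> ratio_dichotomy k -> ratio_dichotomy (h *t k).
Proof.
move=> Qh Qk i j i' j'.
case: (mxtens_indexP i) (mxtens_indexP j) (mxtens_indexP i') (mxtens_indexP j').
move=> i1 i2 [j1 j2] [i1' i2'] [j1' j2'].
have rE x1 x2 y1 y2 z :
    row_ratio (h *t k) (mxtens_index (x1, x2)) (mxtens_index (y1, y2)) z =
    row_ratio h x1 y1 (mxtens_unindex z).1 * row_ratio k x2 y2 (mxtens_unindex z).2.
  case: (mxtens_indexP z) => a b.
  by rewrite /row_ratio !tensmxE mxtens_indexK invfM mulrACA.
have sE : inner_sum (row_ratio (h *t k) (mxtens_index (i1, i2)) (mxtens_index (j1, j2)))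
      (row_ratio (h *t k) (mxtens_index (i1', i2')) (mxtens_index (j1', j2'))) =
    inner_sum (row_ratio h i1 j1) (row_ratio h i1' j1') *
    inner_sum (row_ratio k i2 j2) (row_ratio k i2' j2').
  rewrite /inner_sum mulr_sum; apply: eq_bigr => z _.
  by rewrite !rE rmorphM /= mulrACA.
case: (Qh i1 j1 i1' j1') => [[c c1 cE]|o]; last by right; rewrite sE o mul0r.
case: (Qk i2 j2 i2' j2') => [[d d1 dE]|o]; last by right; rewrite sE o mulr0.
left; exists (c * d) => [|z]; first by rewrite normrM c1 d1 mulr1.
by rewrite !rE cE dE mulrACA.
Qed.

End Ratios.

(** * Fourier matrices and characters of abelian groups *)

Section Fourier.
Variable R : realType.
Local Notation C := R[i].

Definition omega (N : nat) : C := cos (2 * pi / N%:R) +i* sin (2 * pi / N%:R).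

Lemma omegaX N k :
  omega N ^+ k = cos (2 * pi / N%:R * k%:R) +i* sin (2 * pi / N%:R * k%:R).
Proof.
elim: k => [|k IH]; first by rewrite mulr0 cos0 sin0.
rewrite exprS IH -[k.+1%:R]natr1 [_ * (k%:R + 1)]mulrDr mulr1 cosD sinD /omega.
by simpc; congr (_ +i* _); ring.
Qed.

(** If w^k = 1 with 0 < k < N, then 1 - 2 sin^2 t = cos 2t = 1 for t = pi k / N,
    which lies strictly between 0 and pi where the sine is positive. *)
Lemma omega_prim N : (0 < N)%N -> N.-primitive_root (omega N).
Proof.
move=> N0; have N0' : N%:R != 0 :> R by rewrite pnatr_eq0 -lt0n.
apply/andP; split => //; apply/forallP => i; apply/eqP.
rewrite unity_rootE omegaX; have [->|iN] := eqVneq i.+1 N.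
  by rewrite divfK // mulr_natl cos2pi sin2pi; apply/eqP.
have {}iN : (i.+1 < N)%N by rewrite ltn_neqAle iN ltn_ord.
apply/eqP => /eqP; rewrite eq_complex => /andP[/eqP /= c1 _].
pose t : R := pi * i.+1%:R / N%:R.
have t0 : 0 < t by rewrite /t divr_gt0 ?mulr_gt0 ?pi_gt0 ?ltr0n.
have tpi : t < pi.
  rewrite /t ltr_pdivrMr ?ltr0n // ltr_pM2l ?pi_gt0 // ltr_nat //.
have tE : 2 * pi / N%:R * i.+1%:R = t *+ 2 by rewrite /t -mulr_natl; field.
have := @sin_gt0_pi _ t; rewrite t0 tpi => /(_ isT); rewrite tE cos_mulr2n in c1.
have := cos2Dsin2 t; nra.
Qed.

Lemma norm_omega N : `|omega N| = 1.
Proof.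
by rewrite /omega normc_def /= cos2Dsin2 sqrtr1.
Qed.

Lemma fourierE N i j : fourier R N i j = omega N ^+ (i.+1 * j.+1).
Proof. by rewrite mxE. Qed.

(** A ratio of rows is the geometric progression of an N-th root of unity, i.e. a
    character of Z/N, and distinct characters are orthogonal. *)
Lemma ratio_dichotomy_fourier N : (0 < N)%N -> ratio_dichotomy (fourier R N).
Proof.
move=> N0; pose r (i j : 'I_N) : C := omega N ^+ j.+1 / omega N ^+ i.+1.
have rE i j a : row_ratio (fourier R N) i j a = r i j ^+ a.+1.
  by rewrite /row_ratio !fourierE exprMn exprVn -!exprM.
have rN i j : r i j ^+ N = 1.
  rewrite /r exprMn exprVn -!exprM ![(_ * N)%N]mulnC !exprM.
  by rewrite (prim_expr_order (omega_prim N0)) !expr1n divr1.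
have r1 i j : `|r i j| = 1 by rewrite normf_div !normrX norm_omega !expr1n divr1.
move=> i j i' j'; pose z := r i j / r i' j'.
have r0 : r i' j' != 0 by apply: unimod_neq0.
have [z1|z1] := eqVneq z 1.
  left; exists 1; first exact: normr1.
  by move=> a; rewrite mul1r !rE -[r i j](divfK r0) -/z z1 mul1r.
right; rewrite /inner_sum (eq_bigr (fun a : 'I_N => z * z ^+ a)) => [|a _].
  apply: (mulfI (x := z - 1)); first by rewrite subr_eq0.
  rewrite -mulr_sumr mulrCA -subrX1 mulr0 /z exprMn exprVn !rN.
  by rewrite divr1 subrr mulr0.
by rewrite !rE rmorphXn /= -unimodV // -exprMn exprS.
Qed.

Lemma ratio_dichotomy_fourier_tensor n (k : 'M[C]_n) :
  fourier_tensor k -> ratio_dichotomy k.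
Proof.
elim=> [N|p q h' k' _ Qh _ Qk]; first exact: ratio_dichotomy_fourier.
exact: ratio_dichotomy_tens.
Qed.

(** A finite abelian group has a tensor product of Fourier matrices as a
    character table.  Along a decomposition G = <[x]> \x H, the elements are
    enumerated by pairs (power of x, element of H), and a character is
    determined by its value at x, which is a #[x]-th root of unity, and by its
    restriction to H. *)
Lemma abelian_characters (gT : finGroupType) (G : {group gT}) : abelian G ->
  exists D (F : 'M[C]_D) (e : 'I_D -> gT),
  [/\ fourier_tensor F, injective e, (forall x, x \in G <-> exists a, x = e a) &
    forall chi : gT -> C, chi 1%g = 1 ->
      {in G &, {morph chi : x y / (x * y)%g >-> x * y}} ->
      exists j, forall a, chi (e a) = F a j].
Proof.
move=> /abelian_structure[b]; move=> bG _.
elim: b G bG => [|x b IH] G bG.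
  exists 1%N, (fourier R 1), (fun=> 1%g); split.
  - exact: Fourier_single.
  - by move=> i j _; rewrite !ord1.
  - move=> y; move: bG; rewrite big_nil => <-; rewrite inE; split=> [/eqP ->|[_ ->//]].
    by exists 0.
  - move=> chi chi1 _; exists 0 => a.
    by rewrite chi1 fourierE ord1 (prim_expr_order (@omega_prim 1 isT)).
move: bG; rewrite big_cons => /dprodP[[K H _ HE] KH cKH tiKH].
have [D [F [e [tF ie eH eF]]]] := IH H HE.
have N0 := order_gt0 x; set N := #[x]%g in N0.
rewrite HE in KH cKH tiKH.
have xG : x \in G.
  by rewrite -KH; apply: (fintype.subsetP (mulG_subl H _)); exact: cycle_id.
have xiG i : (x ^+ i)%g \in G by rewrite groupX.
have eG a : e a \in G.
  by rewrite -KH; apply: (fintype.subsetP (mulG_subr <[x]> _)); apply/eH; exists a.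
have HG y : y \in H -> y \in G by move=> /eH[a ->].
pose E (k : 'I_(N * D)) := (x ^+ (mxtens_unindex k).1.+1 * e (mxtens_unindex k).2)%g.
exists (N * D)%N, (fourier R N *t F), E; split.
- by apply: Fourier_tens => //; apply: Fourier_single.
- move=> k l; case: (mxtens_indexP k) (mxtens_indexP l) => i a [j c].
  rewrite /E !mxtens_indexK /= => eq.
  have : ((x ^+ j.+1)^-1 * x ^+ i.+1 \in <[x]> :&: H)%g.
    rewrite inE groupM ?groupV ?mem_cycle //=.
    have -> : ((x ^+ j.+1)^-1 * x ^+ i.+1 = e c * (e a)^-1)%g.
      by apply: (mulgI (x ^+ j.+1)%g); apply: (mulIg (e a)); rewrite mulKVg mulgA mulgKV.
    by rewrite groupM ?groupV //; apply/eH; [exists c|exists a].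
  rewrite tiKH inE -eq_mulVg1 => /eqP ij.
  rewrite ij in eq; have /mulgI/ie -> := eq.
  congr (mxtens_index (_, _)); apply/val_inj/eqP => /=.
  move/eqP: ij; rewrite eq_expg_mod_order -/N -addn1 -[i.+1]addn1 eqn_modDr.
  by rewrite !modn_small // eq_sym.
- move=> y; split=> [|[k ->]]; last by rewrite /E groupM.
  rewrite -KH => /mulsgP[_ h /cycleP[i ->] /eH[a ->] ->].
  (* Powers of x are numbered from 1, as are the indices in [fourier]. *)
  have iN : ((i + N.-1) %% N < N)%N by rewrite ltn_mod.
  exists (mxtens_index (Ordinal iN, a)); rewrite /E mxtens_indexK /=.
  congr (_ * _)%g; apply/eqP; rewrite eq_expg_mod_order -/N.
  by rewrite -[(_ %% N).+1]addn1 modnDml -addnA addn1 prednK // modnDr.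
- move=> chi chi1 chiM.
  have chiX i : chi (x ^+ i)%g = chi x ^+ i.
    by elim: i => [|i IHi]; rewrite ?expg0 // expgS chiM // IHi exprS.
  have [j jE] := eF chi chi1 (sub_in2 HG chiM).
  have /(prim_rootP (omega_prim N0))[m mE] : chi x ^+ N = 1.
    by rewrite -chiX expg_order.
  have mN : ((m + N.-1) %% N < N)%N by rewrite ltn_mod.
  have {}mE : chi x = omega N ^+ ((m + N.-1) %% N).+1.
    rewrite mE; apply/eqP; rewrite (eq_prim_root_expr (omega_prim N0)).
    by rewrite -[(_ %% N).+1]addn1 modnDml -addnA addn1 prednK // modnDr.
  exists (mxtens_index (Ordinal mN, j)) => k; case: (mxtens_indexP k) => i a.
  rewrite tensmxE /E mxtens_indexK /= chiM // chiX jE fourierE mE /=.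
  by rewrite -exprM mulnC.
Qed.

End Fourier.

(** * The group of rows *)

Section RowGroup.
Variable R : realType.
Local Notation C := R[i].
Variable n : nat.
Implicit Types h g : 'M[C]_n.+1.

(** The equation h h^* = n for square matrices turns orthogonality of the rows
    into orthogonality of the columns. *)
Lemma hadamard_col h j k : hadamard h ->
  \sum_i (h i j)^* * h i k = (j == k)%:R * n.+1%:R.
Proof.
move=> [h1 ho]; pose H : 'M[C]_n.+1 := n.+1%:R^-1 *: map_mx Num.conj h^T.
have n0 : n.+1%:R != 0 :> C by rewrite pnatr_eq0.
have /mulmx1C/matrixP/(_ j k) : h *m H = 1%:M.
  apply/matrixP => i i'; rewrite -scalemxAr !mxE.
  under eq_bigr do rewrite !mxE.
  have [->|ii'] := eqVneq i i'; last by rewrite ho // mulr0.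
  under eq_bigr do rewrite mulcJ1 //.
  by rewrite sumr_const card_ord -[1 *+ _]/(_%:R) mulVf.
rewrite -scalemxAl !mxE => <-; rewrite mulrAC mulVf // mul1r.
by apply: eq_bigr => i _; rewrite !mxE.
Qed.

Lemma hadamard_row_inj h i i' : hadamard h -> (forall a, h i a = h i' a) -> i = i'.
Proof.
move=> [h1 ho] E; apply/eqP; case: eqVneq => // /ho.
under eq_bigr do rewrite E mulcJ1 //.
by rewrite sumr_const card_ord => /eqP; rewrite pnatr_eq0.
Qed.

Lemma hadamard_col_inj h j k : hadamard h -> (forall i, h i j = h i k) -> j = k.
Proof.
move=> hh E; have := hadamard_col j k hh.
under eq_bigr do rewrite E mulrC (mulcJ1 (hh.1 _ _)).
rewrite sumr_const card_ord; case: eqVneq => // _ /eqP.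
by rewrite mul0r pnatr_eq0.
Qed.

Definition dephased g := (forall i, g i 0 = 1) /\ (forall j, g 0 j = 1).

Lemma dephased_equiv h : unimodular h ->
  exists2 g, hadamard_equiv h g & dephased g.
Proof.
move=> h1; have h0 i j := unimod_neq0 (h1 i j).
exists (\matrix_(i, j) (h i j / h i 0 * (h 0 0 / h 0 j))); last first.
  by split=> [i|j]; rewrite mxE; field; rewrite !h0.
exists 1%g, 1%g, (fun i => (h i 0)^-1), (fun j => h 0 0 / h 0 j); split.
- by move=> i; rewrite normfV h1 invr1.
- by move=> j; rewrite normf_div !h1 divr1.
- by move=> i j; rewrite !mxE !perm1; ring.
Qed.

(** The rows of [g] form an orthogonal basis, so the ratio of two rows, which is
    nonzero, is not orthogonal to all of them.  Rows being ratios by the first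
    row, which is constant, the dichotomy makes the ratio proportional to some
    row, and even equal to it since both start with 1. *)
Lemma dephased_div g : hadamard g -> dephased g -> ratio_dichotomy g ->
  forall i j, exists k, forall a, g k a = g j a / g i a.
Proof.
move=> hg [gi0 g0j] Q i j.
have [[k ko]|no] := pselect (exists k, inner_sum (row_ratio g i j) (g k) <> 0).
  exists k; have := Q i j 0 k; rewrite /row_ratio.
  case=> [[c _ cE]|]; last first.
    by move: ko; rewrite /inner_sum; under [in X in _ -> X -> _]eq_bigr do rewrite g0j divr1.
  have c1 : c = 1 by have := cE 0; rewrite !gi0 !divr1 mulr1 => ->.
  by move=> a; rewrite cE c1 g0j mul1r divr1.
have {}no k : inner_sum (row_ratio g i j) (g k) = 0.
  by apply: contra_notP no => ?; exists k.
have : \sum_k inner_sum (row_ratio g i j) (g k) * g k 0 = n.+1%:R.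
  transitivity (\sum_a row_ratio g i j a * \sum_k (g k a)^* * g k 0).
    under eq_bigr do rewrite /inner_sum mulr_suml.
    rewrite exchange_big; apply: eq_bigr => a _; rewrite mulr_sumr.
    by apply: eq_bigr => k _; rewrite mulrA.
  under eq_bigr do rewrite hadamard_col //.
  rewrite (bigD1 0) //= big1 ?addr0 => [|a /negbTE ->]; last by rewrite mul0r mulr0.
  by rewrite mul1r /row_ratio !gi0 divr1 mul1r.
under eq_bigr do rewrite no mul0r.
by rewrite big1 // => /eqP; rewrite eq_sym pnatr_eq0.
Qed.

(** The product of two rows is the quotient of one by the inverse of the other,
    and the inverse is the quotient of the constant row. *)
Lemma dephased_mul g : hadamard g -> dephased g -> ratio_dichotomy g ->
  exists m : 'I_n.+1 -> 'I_n.+1 -> 'I_n.+1,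
    forall i j a, g (m i j) a = g i a * g j a.
Proof.
move=> hg dg Q; have div := dephased_div hg dg Q.
have mul i : exists f : 'I_n.+1 -> 'I_n.+1, forall j a, g (f j) a = g i a * g j a.
  have [i' i'E] := div i 0.
  have /choice[f fE] : forall j, exists k, forall a, g k a = g i a * g j a.
    move=> j; have [k kE] := div i' j; exists k => a.
    by rewrite kE i'E dg.2 div1r invrK mulrC.
  by exists f.
by have /choice[m mE] := mul; exists m.
Qed.

(** The rows form a group G of order n under the entrywise product, realized by
    translations as a group of permutations of the indices of the rows, so that
    the row of a permutation x is the one of index x 0.  The columns are n
    distinct characters of G, which identifies [g] with a character table of G. *)
Lemma dephased_fourier g : hadamard g -> dephased g -> ratio_dichotomy g ->
  exists k, fourier_tensor k /\ hadamard_equiv g k.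
Proof.
move=> hg dg Q; have [m mE] := dephased_mul hg dg Q.
have rowI i i' := @hadamard_row_inj g i i' hg.
have mI i : injective (m i).
  move=> j j' E; apply: rowI => a; have := mE i j a; rewrite E mE => /mulfI -> //.
  exact: unimod_neq0 (hg.1 i a).
have mC i j : m i j = m j i by apply: rowI => a; rewrite !mE mulrC.
have mA i j k : m i (m j k) = m (m i j) k by apply: rowI => a; rewrite !mE mulrA.
have m0 i : m i 0 = i by apply: rowI => a; rewrite mE dg.2 mulr1.
pose s i := perm (mI i); have s0 i : s i 0 = i by rewrite permE m0.
have sM i j : (s i * s j)%g = s (m i j).
  by apply/permP => k; rewrite permM !permE mA (mC j).
have s1 : s 0 = 1%g by apply/permP => k; rewrite permE perm1 mC m0.
have gs : group_set [set s i | i : 'I_n.+1].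
  apply/group_setP; split; first by apply/imsetP; exists 0.
  move=> _ _ /imsetP[i _ ->] /imsetP[j _ ->]; rewrite sM.
  by apply/imsetP; exists (m i j).
have abG : abelian (Group gs).
  apply/centsP => _ /imsetP[i _ ->] _ /imsetP[j _ ->].
  by rewrite /commute !sM mC.
have [D [F [e [tF ie eG eF]]]] := abelian_characters R abG.
have cardD : D = n.+1.
  rewrite -[LHS]card_ord -(card_codom ie) -[RHS]card_ord.
  have <- : #|[set s i | i : 'I_n.+1]| = #|'I_n.+1|.
    by rewrite card_imset // => i j E; rewrite -(s0 i) E s0.
  apply: eq_card => x; apply/codomP/idP => [[a ->]|/eG//].
  by apply/eG; exists a.
subst D; exists F; split => //.
have eE a : e a = s (e a 0).
  have : e a \in Group gs by apply/eG; exists a.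
  by move=> /imsetP[i _ ->]; rewrite s0.
have pI : injective (fun a => e a 0).
  by move=> a b E; apply: ie; rewrite eE E -eE.
have /choice[c cE] : forall j, exists c, forall a, g (e a 0) j = F a c.
  move=> j; apply: (eF (fun x : {perm _} => g (x 0) j)); first by rewrite perm1 dg.2.
  move=> _ _ /imsetP[i _ ->] /imsetP[k _ ->].
  by rewrite sM !s0 mE.
have cI : injective c.
  move=> j k E; apply: (hadamard_col_inj hg) => i.
  have [a ->] : exists a, i = e a 0.
    have [a aE] : exists a, s i = e a by apply/eG/imsetP; exists i.
    by exists a; rewrite -aE s0.
  by rewrite !cE E.
exists (perm pI), (perm cI)^-1%g, (fun=> 1), (fun=> 1).
split=> [_|_|i j]; rewrite ?normr1 // !mul1r permE.
by rewrite cE -[c _](permE cI) permKV.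
Qed.

Lemma hadamard_dichotomy_fourier h : hadamard h -> ratio_dichotomy h ->
  exists k, fourier_tensor k /\ hadamard_equiv h k.
Proof.
move=> hh Qh; have [g hg dg] := dephased_equiv hh.1.
have [k [tk gk]] := dephased_fourier (hadamard_hadamard_equiv hg hh) dg
  (ratio_dichotomy_equiv hg Qh).
by exists k; split=> //; apply: hadamard_equiv_trans hg gk.
Qed.

End RowGroup.

Import numFieldNormedType.Exports.
Local Open Scope classical_set_scope.
Local Open Scope ring_scope.

(** * The C*-algebra of functions on a finite group *)

Section Completeness.
Variable R : realType.
Local Notation C := R[i].

(** The modulus as a real number, where [`|z|] is a complex number. *)
Definition absc (z : C) : R := complex.Re `|z|.

Lemma absc_norm z : (absc z)%:C = `|z|.
Proof. by rewrite /absc normc_def. Qed.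

Lemma absc_ge0 z : 0 <= absc z.
Proof. by rewrite -ler0c absc_norm. Qed.

Lemma abscM z w : absc (z * w) = absc z * absc w.
Proof. by apply: complexI; rewrite rmorphM /= !absc_norm normrM. Qed.

Lemma abscD z w : absc (z + w) <= absc z + absc w.
Proof. by rewrite -lecR rmorphD /= !absc_norm ler_normD. Qed.

Lemma absc_conj z : absc z^* = absc z.
Proof. by rewrite /absc norm_conjC. Qed.

Lemma absc0 : absc 0 = 0. Proof. by rewrite /absc normr0. Qed.

Lemma absc_eq0 z : absc z = 0 -> z = 0.
Proof. by move=> z0; apply/normr0_eq0; rewrite -absc_norm z0. Qed.

Lemma absc_le_Re_Im z : absc z <= `|complex.Re z| + `|complex.Im z|.
Proof.
rewrite -lecR absc_norm [X in `|X|]complexE; apply: le_trans (ler_normD _ _) _.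
rewrite normrM rmorphD /= lerD //; rewrite normc_def /= ?expr0n ?addr0 ?sqrtr_sqr //.
by rewrite expr1n add0r sqrtr1 mul1r normc_def /= expr0n addr0 sqrtr_sqr.
Qed.

Lemma Re_le_absc z : `|complex.Re z| <= absc z.
Proof. by rewrite -lecR absc_norm; exact: normc_ge_Re. Qed.

Lemma Im_le_absc z : `|complex.Im z| <= absc z.
Proof.
rewrite -normrN -ReiNIm; apply: le_trans (Re_le_absc _) _.
by rewrite abscM {2}/absc normc_def /= expr0n expr1n add0r sqrtr1 mulr1.
Qed.

Lemma real_cauchy_limit (X : Type) (F : set_system X) (FF : ProperFilter F)
    (f : X -> R) :
  (forall e : R, 0 < e ->
    exists2 A, F A & forall x y, A x -> A y -> `|f x - f y| < e) ->
  exists l, forall e : R, 0 < e -> F [set x | `|f x - l| < e].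
Proof.
move=> fF; have /R_complete/cvg_ex[l fl] : cauchy (f @ F).
  apply/cauchy_exP => e e0; have [A FA Ae] := fF e e0.
  have [x0 Ax0] := filter_ex FA; exists (f x0).
  suff : F [set x | ball (f x0) e (f x)] by [].
  by apply: filterS FA => x Ax; rewrite /= -ball_normE /=; apply: Ae.
by exists l => e e0; move/cvgrPdistC_lt: fl => /(_ e e0).
Qed.

(** Completeness of C^T, for an arbitrary filter on a set of parameters so that
    it yields both the completeness of an algebra of functions, stated with
    sequences, and that of a Hilbert space, stated with Cauchy filters. *)
Lemma cauchy_limit (X : Type) (F : set_system X) (FF : ProperFilter F)
    (T : finType) (f : X -> T -> C) :
  (forall e : R, 0 < e -> exists2 A, F A &
     forall x y, A x -> A y -> forall t, absc (f x t - f y t) < e) ->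
  exists l : T -> C, forall e : R, 0 < e ->
    F [set x | forall t, absc (f x t - l t) < e].
Proof.
move=> fF.
have /choice[a aE] : forall t, exists l, forall e : R, 0 < e ->
    F [set x | `|complex.Re (f x t) - l| < e].
  move=> t; apply: real_cauchy_limit => e /fF[A FA Ae]; exists A => // x y Ax Ay.
  apply: le_lt_trans (Ae _ _ Ax Ay t); apply: le_trans (Re_le_absc _).
  by rewrite (raddfB (@complex.Re R : Rcomplex R -> R)).
have /choice[b bE] : forall t, exists l, forall e : R, 0 < e ->
    F [set x | `|complex.Im (f x t) - l| < e].
  move=> t; apply: real_cauchy_limit => e /fF[A FA Ae]; exists A => // x y Ax Ay.
  apply: le_lt_trans (Ae _ _ Ax Ay t); apply: le_trans (Im_le_absc _).
  by rewrite (raddfB (@complex.Im R : Rcomplex R -> R)).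
exists (fun t => a t +i* b t) => e e0; apply: filter_forall => t.
have e20 : 0 < e / 2 by rewrite divr_gt0.
apply: filterS (filterI (aE t _ e20) (bE t _ e20)) => x [ax bx] /=.
apply: le_lt_trans (absc_le_Re_Im _) _; rewrite [e]splitr.
rewrite (raddfB (@complex.Re R : Rcomplex R -> R)).
by rewrite (raddfB (@complex.Im R : Rcomplex R -> R)) ltrD.
Qed.

End Completeness.

(** The functions are taken on a finite group rather than on a finite set: a group
    is nonempty, so that 1 != 0 holds, and it is where coproduct, counit and
    antipode come from. *)
Definition fun_alg (R : realType) (G : finGroupType) : Type := {ffun G -> R[i]^o}.

Section FunAlg.
Variables (R : realType) (G : finGroupType).
Local Notation C := R[i].
Local Notation A := (fun_alg R G).

HB.instance Definition _ := GRing.Lmodule.copy A {ffun G -> C^o}.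
HB.instance Definition _ := GRing.PzRing.copy A {ffun G -> C^o}.

Let fun_alg_nz : 1 != 0 :> A.
Proof. by apply/eqP => /ffunP/(_ 1%g)/eqP; rewrite !ffunE oner_eq0. Qed.

HB.instance Definition _ := GRing.PzSemiRing_isNonZero.Build A fun_alg_nz.

Let fun_alg_Al (c : C) (f g : A) : c *: (f * g) = (c *: f) * g.
Proof. by apply/ffunP => t; rewrite !ffunE scalerAl. Qed.

HB.instance Definition _ := GRing.Lmodule_isLalgebra.Build C A fun_alg_Al.

Let fun_alg_Ar (c : C) (f g : A) : c *: (f * g) = f * (c *: g).
Proof. by apply/ffunP => t; rewrite !ffunE scalerAr. Qed.

HB.instance Definition _ := GRing.Lalgebra_isAlgebra.Build C A fun_alg_Ar.

Lemma fun_algM (f g : A) t : (f * g) t = f t * g t.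
Proof. by rewrite ffunE. Qed.

Lemma fun_algC (f g : A) : f * g = g * f.
Proof. by apply/ffunP => t; rewrite !fun_algM mulrC. Qed.

Definition fun_star (f : A) : A := [ffun t => (f t)^*].

Let fun_starK : involutive fun_star.
Proof. by move=> f; apply/ffunP => t; rewrite !ffunE conjCK. Qed.
Let fun_starD : {morph fun_star : f g / f + g}.
Proof. by move=> f g; apply/ffunP => t; rewrite !ffunE rmorphD. Qed.
Let fun_starZ (c : C) (f : A) : fun_star (c *: f) = c^* *: fun_star f.
Proof. by apply/ffunP => t; rewrite !ffunE; exact: rmorphM. Qed.
Let fun_starM (f g : A) : fun_star (f * g) = fun_star g * fun_star f.
Proof. by apply/ffunP => t; rewrite !ffunE rmorphM mulrC. Qed.

HB.instance Definition _ := @isStarAlgebra.Build R A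
  fun_star fun_starK fun_starD fun_starZ fun_starM.

Definition sup_norm (f : A) : R := \big[Num.max/0]_t absc (f t).

Lemma absc_le_sup (f : A) t : absc (f t) <= sup_norm f.
Proof. exact: le_bigmax. Qed.

Lemma sup_norm_le (f : A) (c : R) :
  0 <= c -> (forall t, absc (f t) <= c) -> sup_norm f <= c.
Proof. by move=> c0 fc; apply: bigmax_le. Qed.

Lemma sup_norm_lt (f : A) (c : R) :
  0 < c -> (forall t, absc (f t) < c) -> sup_norm f < c.
Proof. by move=> c0 fc; apply/bigmax_ltP. Qed.

Lemma sup_norm_ge0 (f : A) : 0 <= sup_norm f.
Proof. by apply: le_trans (absc_ge0 (f 1%g)) (absc_le_sup f _). Qed.

Let sup_norm0 (f : A) : sup_norm f = 0 -> f = 0.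
Proof.
move=> f0; apply/ffunP => t; rewrite ffunE; apply: absc_eq0; apply/le_anti.
by rewrite absc_ge0 -f0 absc_le_sup.
Qed.

Let sup_normD (f g : A) : sup_norm (f + g) <= sup_norm f + sup_norm g.
Proof.
apply: sup_norm_le => [|t]; first by rewrite addr_ge0 ?sup_norm_ge0.
by rewrite ffunE (le_trans (abscD _ _)) // lerD ?absc_le_sup.
Qed.

Let sup_normZ_le (c : C) (f : A) : sup_norm (c *: f) <= absc c * sup_norm f.
Proof.
apply: sup_norm_le => [|t]; first by rewrite mulr_ge0 ?absc_ge0 ?sup_norm_ge0.
by rewrite ffunE abscM ler_wpM2l ?absc_ge0 ?absc_le_sup.
Qed.

Let sup_normZ (c : C) (f : A) : sup_norm (c *: f) = complex.Re `|c| * sup_norm f.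
Proof.
rewrite -/(absc c); apply/le_anti; rewrite sup_normZ_le andTb.
have [->|c0] := eqVneq c 0; first by rewrite absc0 mul0r sup_norm_ge0.
have ac0 : 0 < absc c.
  by rewrite lt_def absc_ge0 andbT; apply: contra_neq c0; exact: absc_eq0.
rewrite -ler_pdivlMl //.
have -> : (absc c)^-1 = absc c^-1.
  apply: (mulfI (lt0r_neq0 ac0)); rewrite mulfV ?lt0r_neq0 // -abscM divff //.
  by rewrite /absc normr1.
by rewrite -{1}[f](scalerK c0) sup_normZ_le.
Qed.

Let sup_normM (f g : A) : sup_norm (f * g) <= sup_norm f * sup_norm g.
Proof.
apply: sup_norm_le => [|t]; first by rewrite mulr_ge0 ?sup_norm_ge0.
by rewrite fun_algM abscM ler_pM ?absc_ge0 ?absc_le_sup.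
Qed.

(** For the nontrivial inequality each |f t| is at most the square root of the
    norm of f^* f. *)
Let sup_norm_star (f : A) : sup_norm (star f * f) = sup_norm f ^+ 2.
Proof.
have E t : absc ((star f * f) t) = absc (f t) ^+ 2.
  by rewrite fun_algM ffunE abscM absc_conj expr2.
apply/le_anti/andP; split.
  apply: sup_norm_le => [|t]; first by rewrite exprn_ge0 ?sup_norm_ge0.
  by rewrite E lerXn2r ?nnegrE ?sup_norm_ge0 ?absc_ge0 ?absc_le_sup.
rewrite -[leRHS]sqr_sqrtr ?sup_norm_ge0 //.
rewrite lerXn2r ?nnegrE ?sup_norm_ge0 ?sqrtr_ge0 //.
apply: sup_norm_le => [|t]; first exact: sqrtr_ge0.
rewrite -[leLHS]ger0_norm ?absc_ge0 // -sqrtr_sqr ler_wsqrtr // -E.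
exact: absc_le_sup.
Qed.

Let sup_norm_complete (s : nat -> A) :
  (forall e : R, 0 < e -> exists N, forall m n, (N <= m)%N -> (N <= n)%N ->
     sup_norm (s m - s n) < e) ->
  exists l : A, forall e : R, 0 < e -> exists N, forall n, (N <= n)%N ->
     sup_norm (s n - l) < e.
Proof.
move=> sC; have [|l lE] := @cauchy_limit R nat \oo _ G (fun n t => s n t).
  move=> e /sC[N NE]; exists [set m | (N <= m)%N]; first exact: nbhs_infty_ge.
  move=> m n Nm Nn t; apply: le_lt_trans (NE m n Nm Nn).
  by have := absc_le_sup (s m - s n) t; rewrite !ffunE.
exists [ffun t => l t] => e e0; have [N _ NE] := lE e e0.
exists N => n Nn; apply: sup_norm_lt => // t; rewrite !ffunE.
exact: NE.
Qed.

HB.instance Definition _ := @isCStar.Build R A sup_norm sup_norm0 sup_normD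
  sup_normZ sup_normM sup_norm_star sup_norm_complete.

End FunAlg.

(** * The Hilbert space of functions on a finite set *)

Definition ell2 (R : realType) (T : finType) : Type := {ffun T -> R[i]^o}.

Section Ell2.
Variables (R : realType) (T : finType).
Local Notation C := R[i].
Local Notation H := (ell2 R T).

HB.instance Definition _ := Vector.copy H {ffun T -> C^o}.

Definition ell2_dot (f g : H) : C := \sum_t f t * (g t)^*.

Let ell2_dot_bilinear : bilinear_for
  (GRing.Scale.Law.clone _ _ *%R _)
  (GRing.Scale.Law.clone _ _ (Num.conj \; *%R) _) ell2_dot.
Proof.
split=> [g|f] c u v; rewrite /ell2_dot /= mulr_sumr -big_split; apply: eq_bigr => t _.
  by rewrite !ffunE mulrDl mulrA.
by rewrite !ffunE rmorphD rmorphM /= mulrDr mulrCA.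
Qed.

HB.instance Definition _ :=
  bilinear_isBilinear.Build C H H C _ _ ell2_dot ell2_dot_bilinear.

Let ell2_dot_herm (f g : H) : ell2_dot f g = (-1) ^+ false * (ell2_dot g f)^*.
Proof.
rewrite expr0 mul1r /ell2_dot rmorph_sum; apply: eq_bigr => t _.
by rewrite rmorphM /= conjCK mulrC.
Qed.

HB.instance Definition _ :=
  isHermitianSesquilinear.Build C H false Num.conj ell2_dot ell2_dot_herm.

Let ell2_dot_gt0 (f : H) : f != 0 -> 0 < ell2_dot f f.
Proof.
move=> f0; rewrite lt_def; apply/andP; split; last first.
  by apply: sumr_ge0 => t _; rewrite -normCK exprn_ge0.
apply: contra_neq f0 => /eqP.
rewrite psumr_eq0 => [/allP f0|t _]; last by rewrite -normCK exprn_ge0.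
apply/ffunP => t; rewrite ffunE; have := f0 t (mem_index_enum _).
by rewrite -normCK sqrf_eq0 normr_eq0 => /eqP.
Qed.

HB.instance Definition _ := isDotProduct.Build C H ell2_dot ell2_dot_gt0.

Definition ell2_norm (f : H) : C := sqrtC (ell2_dot f f).

Let ell2_normD (f g : H) : ell2_norm (f + g) <= ell2_norm f + ell2_norm g.
Proof. exact: (triangle_lerif ell2_dot f g).1. Qed.

Let ell2_normZ (c : C) (f : H) : ell2_norm (c *: f) = `|c| * ell2_norm f.
Proof.
rewrite /ell2_norm (dnormZ ell2_dot) sqrtCM ?nnegrE ?exprn_ge0 ?dnorm_ge0 //.
by rewrite sqrCK.
Qed.

Let ell2_norm0 (f : H) : ell2_norm f = 0 -> f = 0.
Proof. by move/eqP; rewrite sqrtC_eq0 (dnorm_eq0 ell2_dot) => /eqP. Qed.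

HB.instance Definition _ := Lmodule_isNormed.Build C H
  ell2_normD ell2_normZ ell2_norm0.

Lemma ell2_normE (f : H) : `|f| ^+ 2 = \sum_t `|f t| ^+ 2.
Proof. by rewrite sqrtCK; apply: eq_bigr => t _; rewrite normCK. Qed.

Lemma coord_le_ell2 (f : H) t : `|f t| <= `|f|.
Proof.
rewrite -ler_sqr ?nnegrE // ell2_normE (bigD1 t) //= lerDl.
by apply: sumr_ge0 => s _; rewrite exprn_ge0.
Qed.

(** Together with [coord_le_ell2] this makes convergence in norm the same as
    convergence of all coordinates. *)
Lemma ell2_le_sum (f : H) : `|f| <= \sum_t `|f t|.
Proof.
have s0 : 0 <= \sum_t `|f t| by apply: sumr_ge0.
rewrite -ler_sqr ?nnegrE // ell2_normE [leRHS]expr2 mulr_suml.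
apply: ler_sum => t _; rewrite expr2 ler_wpM2l //.
by rewrite (bigD1 t) //= lerDl sumr_ge0.
Qed.

Let ell2_complete (F : set_system H) : ProperFilter F -> cauchy F -> cvg F.
Proof.
move=> FF /cauchy_ballP FC.
have [|l lE] := @cauchy_limit R H F FF T (fun f t => f t).
  move=> e e0; have [|[A B] [FA FB] AB] := FC (e%:C); first by rewrite ltcR.
  exists (A `&` B); first exact: filterI.
  move=> f g [Af _] [_ Bg] t; rewrite -ltcR absc_norm.
  apply: le_lt_trans (AB (f, g) (conj Af Bg)).
  by have := coord_le_ell2 (f - g) t; rewrite !ffunE.
apply/cvg_ex; exists ([ffun t => l t] : H); apply/cvgrPdistC_lt => e e0.
have eR : e = (complex.Re e)%:C by rewrite RRe_real // ger0_real // ltW.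
have e0' : 0 < complex.Re e by rewrite -ltcR -eR.
(* The successor covers the case of an empty T. *)
have d0 : 0 < complex.Re e / (#|T|.+1)%:R by rewrite divr_gt0.
apply: filterS (lE _ d0) => f fl; apply: le_lt_trans (ell2_le_sum _) _.
apply: (@le_lt_trans _ _ (\sum_(t : T) (complex.Re e / (#|T|.+1)%:R)%:C)).
  by apply: ler_sum => t _; rewrite !ffunE -absc_norm lecR ltW.
rewrite sumr_const eR -rmorphMn ltcR /= -mulr_natr mulrAC ltr_pdivrMr //.
by rewrite ltr_pM2l // ltr_nat.
Qed.

HB.instance Definition _ := Uniform_isComplete.Build H ell2_complete.

Let ell2_norm_dot (f : H) : `|f| ^+ 2 = ell2_dot f f.
Proof. exact: sqrtCK. Qed.

HB.instance Definition _ := @isHilbert.Build R H ell2_dot ell2_norm_dot.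

End Ell2.

(** * Functions on the symmetric group as a quantum permutation algebra *)

Section SpectralHom.
Variables (R : realType) (G : finGroupType) (B : starAlgType R) (n : nat).
Variables (p : 'I_n -> B) (s : 'I_n -> G).
Hypothesis hp : partition_of_unity p.
Local Notation C := R[i].

(** The proof that p is a partition of unity is an argument because the
    structure of morphism of this function depends on it. *)
Definition spectral_hom of partition_of_unity p :=
  fun f : fun_alg R G => \sum_k f (s k) *: p k.
Local Notation F := (spectral_hom hp).

Let F_linear : linear F.
Proof.
move=> c f g; rewrite /spectral_hom scaler_sumr -big_split; apply: eq_bigr => k _.
by rewrite !ffunE scalerDl scalerA.
Qed.

HB.instance Definition _ := GRing.isLinear.Build C (fun_alg R G) B *:%R F F_linear.

Let F_monoid : monoid_morphism F.
Proof.
have [pp po p1] := hp; split=> [|f g]; rewrite /spectral_hom.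
  by rewrite -p1; apply: eq_bigr => k _; rewrite ffunE scale1r.
rewrite mulr_suml; apply: eq_bigr => k _.
rewrite mulr_sumr (bigD1 k) //= big1 ?addr0 => [|l lk].
  by rewrite -scalerAl -scalerAr (pp k).1 scalerA fun_algM.
by rewrite -scalerAl -scalerAr po ?scaler0 // eq_sym.
Qed.

HB.instance Definition _ := GRing.isMonoidMorphism.Build (fun_alg R G) B F F_monoid.

Let F_star : {morph F : a / star a >-> star a}.
Proof.
move=> f; have [pp _ _] := hp; rewrite /spectral_hom (big_morph _ (@starD R B) (id1 := 0)).
  by apply: eq_bigr => k _; rewrite starZ (pp k).2 ffunE.
by have := @starZ R B 0 0; rewrite !scale0r rmorph0 scale0r.
Qed.

HB.instance Definition _ := isStarMorphism.Build R (fun_alg R G) B F F_star.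

(** A partition of unity p and points s_k define the morphism
    f |-> sum_k f(s_k) p_k: the relations of the p_k are exactly what makes it
    multiplicative, unital and compatible with the involutions.  The coproduct,
    the counit, the antipode and the representation on matrices are of this form. *)
Lemma spectral_hom_exists :
  exists f : starHom (fun_alg R G) B, forall a, f a = \sum_k a (s k) *: p k.
Proof. by exists F. Qed.

End SpectralHom.

Section Deltas.
Variables (R : realType).
Local Notation C := R[i].

Definition delta (T : finType) (x : T) : {ffun T -> C^o} := [ffun y => (y == x)%:R].

Lemma sum_delta (T : finType) (f : T -> C) :
  \sum_(k < #|T|) f (enum_val k) *: delta (enum_val k) = [ffun x => f x].
Proof.
rewrite -(reindex (@enum_val T predT) (P := predT) (F := fun y => f y *: delta y)) /=; last first.
  by apply: onW_bij; exact: enum_val_bij.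
apply/ffunP => x; rewrite sum_ffunE (bigD1 x) //= big1 => [|y yx].
  by rewrite !ffunE eqxx addr0; exact: mulr1.
by rewrite !ffunE eq_sym (negbTE yx) scaler0.
Qed.

Lemma linear_span_delta (T : finType) (S : set {ffun T -> C^o}) :
  (forall x, S (delta x)) -> linear_span S = setT.
Proof.
move=> Sd; apply/seteqP; split => // f _.
exists #|T|, (fun k => f (enum_val k)), (fun k => delta (enum_val k)).
by split=> [k|]; [exact: Sd | rewrite sum_delta; apply/ffunP => x; rewrite ffunE].
Qed.

Variable G : finGroupType.

Lemma delta_partition :
  partition_of_unity (fun k : 'I_#|G| => delta (enum_val k) : fun_alg R G).
Proof.
split=> [k|k l kl|].
- split; apply/ffunP => x; rewrite !ffunE; first by rewrite -natrM mulnb andbb.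
  by rewrite conjC_nat.
- apply/ffunP => x; rewrite !ffunE -natrM mulnb; case: eqP => //= ->.
  by rewrite (inj_eq enum_val_inj) (negbTE kl).
- have /= := sum_delta (fun _ : G => 1); under eq_bigr do rewrite scale1r.
  by move=> ->; apply/ffunP => x; rewrite !ffunE.
Qed.

Lemma delta_partition_conv :
  partition_of_unity (fun k : 'I_#|G| => delta (enum_val k) : (fun_alg R G)^c).
Proof.
have [dp dort d1] := delta_partition; split=> [k|k l kl|]; [exact: dp| |exact: d1].
by apply: dort; rewrite eq_sym.
Qed.

Lemma pullback_hom (G' : finGroupType) (phi : G -> G') :
  exists f : starHom (fun_alg R G') (fun_alg R G), forall a x, f a x = a (phi x).
Proof.
have [f fE] := spectral_hom_exists (fun k => phi (enum_val k)) delta_partition.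
exists f => a x; rewrite fE.
by have /= -> := sum_delta (fun x => a (phi x)); rewrite ffunE.
Qed.

Lemma antipode_hom :
  exists f : starHom (fun_alg R G) (fun_alg R G)^c,
    forall a x, (f a : fun_alg R G) x = a x^-1%g.
Proof.
have [f fE] := spectral_hom_exists (fun k => (enum_val k)^-1%g) delta_partition_conv.
exists f => a x; rewrite fE.
by have /= -> := sum_delta (fun x => a x^-1%g); rewrite ffunE.
Qed.

Lemma counit_hom :
  exists f : starHom (fun_alg R G) C^o, forall a, f a = a 1%g.
Proof.
have hp : partition_of_unity (fun _ : 'I_1 => 1 : C^o).
  split=> [k|k l|]; last by rewrite big_ord1.
    by split; [exact: mulr1|exact: conjC1].
  by rewrite !ord1 eqxx.
have [f fE] := spectral_hom_exists (fun _ : 'I_1 => 1%g : G) hp.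
by exists f => a; rewrite fE big_ord1; exact: mulr1.
Qed.

Definition mult_rep (a : fun_alg R G) (f : ell2 R G) : ell2 R G :=
  [ffun x => a x * f x].

(** Multiplication by a is bounded by the supremum of |a|, and a is recovered from
    the image of the constant function 1. *)
Lemma mult_rep_faithful : faithful_rep mult_rep.
Proof.
split.
- move=> a; split=> [c f g|].
    by apply/ffunP => x; rewrite !ffunE mulrDr; congr (_ + _); exact: mulrCA.
  move=> f; apply/(@cvgrPdist_lt C (ell2 R G) _ (nbhs f) (nbhs_filter f)) => e e0.
  (* The bound is increased by 1 to be nonzero even for a = 0. *)
  have M0 : 0 < 1 + (sup_norm a)%:C by rewrite ltr_wpDr // ler0c sup_norm_ge0.
  near=> g.
  have -> : mult_rep a f - mult_rep a g = mult_rep a (f - g).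
    by apply/ffunP => x; rewrite !ffunE mulrBr.
  apply: (@le_lt_trans _ _ ((1 + (sup_norm a)%:C) * `|f - g|)).
    rewrite -ler_sqr ?nnegrE ?mulr_ge0 ?(ltW M0) // exprMn !ell2_normE mulr_sumr.
    apply: ler_sum => x _; rewrite ffunE normrM exprMn ler_wpM2r ?exprn_ge0 //.
    rewrite ler_sqr ?nnegrE ?(ltW M0) //.
    apply: ler_wpDl => //; rewrite -absc_norm lecR; exact: absc_le_sup.
  rewrite -ltr_pdivlMl //; near: g.
  by apply: cvgr_dist_lt; rewrite // mulr_gt0 ?invr_gt0.
- move=> f c a b; apply/ffunP => x; rewrite !ffunE mulrDl.
  by congr (_ + _); symmetry; exact: mulrA.
- split=> [f|a b f]; apply/ffunP => x; rewrite !ffunE ?mul1r //.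
  by rewrite mulrA.
- move=> a f g; apply: eq_bigr => x _; rewrite !ffunE rmorphM /= conjCK.
  by rewrite mulrCA mulrA.
- move=> a a0; apply/ffunP => x; have /ffunP/(_ x) := a0 [ffun=> 1].
  by rewrite !ffunE mulr1.
Unshelve. all: by end_near. Qed.

(** Functions u_k(x) = [s_k(x) = v(x)] form a partition of unity as soon as for
    every x exactly one k satisfies the equation; rows and columns of the matrix
    of coordinates of a permutation are two instances. *)
Lemma indicator_partition (n : nat) (T : eqType) (s : 'I_n -> G -> T)
    (v : G -> T) (u : 'I_n -> fun_alg R G) :
  (forall k x, u k x = (s k x == v x)%:R) ->
  (forall x, exists2 k, s k x = v x & forall l, s l x = v x -> l = k) ->
  partition_of_unity u.
Proof.
move=> uE uk; split=> [k|k l kl|].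
- split; apply/ffunP => x; rewrite !ffunE uE ?conjC_nat //.
  by rewrite -natrM mulnb andbb.
- apply/ffunP => x; rewrite !ffunE !uE -natrM mulnb.
  have [m _ mE] := uk x; case: eqP => //= /mE km; case: eqP => //= /mE lm.
  by rewrite km lm eqxx in kl.
- apply/ffunP => x; rewrite sum_ffunE ffunE; have [m ms mE] := uk x.
  rewrite (bigD1 m) //= big1 => [|l lm]; first by rewrite uE ms eqxx addr0.
  by rewrite uE; case: eqP => // /mE lm'; rewrite lm' eqxx in lm.
Qed.

End Deltas.

Section Tensor.
Variables (R : realType) (G G' : finGroupType).
Local Notation C := R[i].

(** Stated for plain functions, so as to serve both as the elementary tensors of
    the Hilbert spaces and as those of the algebras. *)
Definition fun_tensor (T T' : finType) (a : {ffun T -> C^o}) (b : {ffun T' -> C^o}) :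
  {ffun (T * T')%type -> C^o} := [ffun x => (a x.1 : C) * b x.2].

Lemma fun_tensor_delta (T T' : finType) (x : T) (y : T') :
  fun_tensor (delta R x) (delta R y) = delta R (x, y).
Proof. by apply/ffunP => -[x' y']; rewrite !ffunE /= -natrM mulnb xpair_eqE. Qed.

Lemma ell2_tensor : hilbert_tensor
  (@fun_tensor G G' : ell2 R G -> ell2 R G' -> ell2 R (G * G')%type).
Proof.
split.
- move=> g c f f'; apply/ffunP => x; rewrite !ffunE mulrDl.
  by congr (_ + _); symmetry; exact: mulrA.
- move=> f c g g'; apply/ffunP => x; rewrite !ffunE mulrDr.
  by congr (_ + _); exact: mulrCA.
- move=> f g f' g'; transitivity ((\sum_x f x * (f' x)^*) * (\sum_y g y * (g' y)^*)).
    rewrite mulr_suml; under [RHS]eq_bigr do rewrite mulr_sumr.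
    rewrite pair_bigA; apply: eq_bigr => -[x y] _ /=.
    by rewrite !ffunE rmorphM mulrACA.
  by [].
- apply/seteqP; split=> // f _; apply: subset_closure.
  rewrite (linear_span_delta (T := (G * G')%type)) //.
  move=> [x y]; exists (delta R x), (delta R y).
  by rewrite fun_tensor_delta.
Qed.

(** The tensor product of C(G) and C(G') is C(G x G'), acting by multiplication
    on the square summable functions on G x G'; in finite dimension the elementary
    tensors span, without closure. *)
Lemma fun_alg_tensor : cstar_tensor
  (@fun_tensor G G' : fun_alg R G -> fun_alg R G' -> fun_alg R (G * G')%type).
Proof.
split.
  apply/seteqP; split=> // f _ e e0; exists f; last first.
    rewrite subrr; apply: sup_norm_lt => // x.
    by rewrite ffunE absc0.
  rewrite (linear_span_delta (T := (G * G')%type)) //.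
  move=> [x y]; exists (delta R x), (delta R y).
  by rewrite fun_tensor_delta.
exists (ell2 R G), (ell2 R G'), (ell2 R (G * G')%type), (@fun_tensor G G').
exists (@mult_rep R G), (@mult_rep R G'), (@mult_rep R (G * G')%type).
split; try exact: mult_rep_faithful; first exact: ell2_tensor.
by move=> a b f g; apply/ffunP => x; rewrite !ffunE mulrACA.
Qed.

End Tensor.

Section Permutations.
Variables (R : realType) (n : nat).
Local Notation C := R[i].
Local Notation A := (fun_alg R {perm 'I_n}).

Definition perm_coord : 'M[A]_n :=
  \matrix_(i, j) [ffun s : {perm 'I_n} => (s i == j)%:R].

Lemma perm_coordE i j (s : {perm 'I_n}) : perm_coord i j s = (s i == j)%:R.
Proof. by rewrite mxE ffunE. Qed.

Lemma perm_coord_magic : magic_unitary perm_coord.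
Proof.
split=> i.
  apply: (@indicator_partition R {perm 'I_n} _ _ (fun k _ => k) (fun x => x i)) => [k x|x].
    by rewrite perm_coordE eq_sym.
  by exists (x i).
apply: (@indicator_partition R {perm 'I_n} _ _ (fun k x => x k) (fun x => i)) => [k x|x].
  by rewrite perm_coordE.
by exists (x^-1 i)%g => [|l <-]; rewrite ?permKV ?permK.
Qed.

(** The indicator function of a permutation s is the product over i of the
    coordinates u_(i, s i). *)
Lemma perm_coord_generate : entries_generate perm_coord.
Proof.
move=> B [_ B1 BL BM _] Bu; have B0 : B 0.
  by have := BL (-1) _ _ B1 B1; rewrite scaleN1r addNr.
have Bsum (I : finType) (f : I -> A) c : (forall i, B (f i)) -> B (\sum_i c i *: f i).
  by move=> Bf; elim/big_rec: _ => // i x _; exact: BL.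
have Bprod (I : Type) (r : seq I) (f : I -> A) : (forall i, B (f i)) -> B (\prod_(i <- r) f i).
  by move=> Bf; elim/big_rec: _ => // i x _; exact: BM.
apply/seteqP; split=> // f _.
have -> : f = \sum_(k < #|{perm 'I_n}|) f (enum_val k) *: (delta R (enum_val k) : A).
  by have /= -> := sum_delta f; apply/ffunP => x; rewrite ffunE.
apply: (Bsum _ (fun k => delta R (enum_val k) : A)) => k; set s := enum_val k.
suff <- : \prod_i perm_coord i (s i) = delta R s by apply: Bprod => i; apply: Bu.
apply/ffunP => x; rewrite ffunE.
have -> : (\prod_i perm_coord i (s i)) x = \prod_i perm_coord i (s i) x.
  by elim/big_rec2: _ => [|i a b _ <-]; rewrite ?ffunE // fun_algM.
under eq_bigr do rewrite perm_coordE.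
have [->|xs] := eqVneq x s; first by rewrite big1 // => i _; rewrite eqxx.
have [i xsi] : exists i, x i != s i.
  apply/existsP; apply: contraR xs => /existsPn xs; apply/eqP/permP => i.
  by apply/eqP; rewrite -[_ == _]negbK xs.
by rewrite (bigD1 i) //= (negbTE xsi) mul0r.
Qed.

(** The coproduct is dual to the product of permutations, written in the order
    for which (x * y) i = y (x i), the counit is evaluation at the identity and
    the antipode is composition with the inverse. *)
Lemma perm_coord_qpa : quantum_permutation_algebra perm_coord.
Proof.
split; [exact: perm_coord_magic|exact: perm_coord_generate| | |].
- exists (fun_alg R ({perm 'I_n} * {perm 'I_n})%type), (@fun_tensor R _ _).
  split; first exact: fun_alg_tensor.
  have [f fE] := @pullback_hom R _ _ (fun x : {perm 'I_n} * {perm 'I_n} => (x.1 * x.2)%g).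
  exists f => i j; apply/ffunP => x; rewrite fE perm_coordE sum_ffunE permM.
  rewrite (bigD1 (x.1 i)) //= big1 => [|k xk].
    by rewrite ffunE !perm_coordE eqxx mul1r addr0.
  by rewrite ffunE !perm_coordE eq_sym (negbTE xk) mul0r.
- have [f fE] := @counit_hom R {perm 'I_n}; exists f => i j.
  by rewrite fE perm_coordE perm1.
- have [f fE] := @antipode_hom R {perm 'I_n}; exists f => i j.
  apply/ffunP => x; rewrite [LHS]fE !perm_coordE.
  by rewrite -(inj_eq (@perm_inj _ x)) permKV eq_sym.
Qed.

End Permutations.

(** * Continuity of morphisms to matrices *)

Section Neumann.
Variables (R : realType) (A : cstarAlgType R).
Local Notation C := R[i].
Implicit Types a b : A.

Lemma cnorm0 : cnorm (0 : A) = 0.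
Proof. by rewrite -[0 in LHS](scale0r (0 : A)) cnormZ normr0 mul0r. Qed.

Lemma cnormN a : cnorm (- a) = cnorm a.
Proof. by rewrite -scaleN1r cnormZ normrN normr1 mul1r. Qed.

Lemma cnorm_ge0 a : 0 <= cnorm a.
Proof. by have := ler_cnormD a (- a); rewrite subrr cnorm0 cnormN; lra. Qed.

Lemma star1 : star (1 : A) = 1.
Proof. by rewrite -[LHS]mulr1 -{2}[1](starK (1 : A)) -starM mulr1 starK. Qed.

Lemma cnorm1_le : cnorm (1 : A) <= 1.
Proof.
have := cnorm_star (1 : A); rewrite star1 mulr1 => E.
have := cnorm_ge0 (1 : A); nra.
Qed.

Lemma cnormX_le a n : cnorm (a ^+ n) <= cnorm a ^+ n.
Proof.
elim: n => [|n IH]; first by rewrite !expr0 cnorm1_le.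
rewrite !exprS; apply: le_trans (ler_cnormM _ _) _.
by rewrite ler_wpM2l ?cnorm_ge0.
Qed.

(** The inverse is the limit of the partial sums of the geometric series. *)
Lemma neumann_right_inverse b : cnorm b < 1 -> exists c, (1 - b) * c = 1.
Proof.
set q := cnorm b => q1; have q0 : 0 <= q := cnorm_ge0 b.
pose s n := \sum_(k < n) b ^+ k.
have tail n d : (1 - q) * cnorm (s (n + d)%N - s n) <= q ^+ n - q ^+ (n + d).
  elim: d => [|d IH]; first by rewrite addn0 !subrr cnorm0 mulr0.
  rewrite addnS /s big_ord_recr /= -/(s _) -/(s _) addrAC.
  have := ler_cnormD (s (n + d)%N - s n) (b ^+ (n + d)).
  have := cnormX_le b (n + d); rewrite exprS -/q; nra.
have qsmall e : 0 < e -> exists N, forall n, (N <= n)%N -> q ^+ n < e.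
  move=> e0; have := @cvg_expr R q; rewrite ger0_norm // => /(_ q1).
  move=> /cvgrPdist_lt/(_ e e0)[N _ NE]; exists N => n Nn.
  by have := NE n Nn; rewrite /= sub0r normrN ger0_norm ?exprn_ge0.
have sC e : 0 < e -> exists N, forall m n, (N <= m)%N -> (N <= n)%N ->
    cnorm (s m - s n) < e.
  move=> e0; have [|N NE] := qsmall ((1 - q) * e); first by rewrite mulr_gt0 ?subr_gt0.
  exists N; suff le m n : (N <= n)%N -> (n <= m)%N -> cnorm (s m - s n) < e.
    move=> m n Nm Nn; have [nm|/ltnW mn] := leqP n m; first exact: le.
    by rewrite -opprB cnormN le.
  move=> Nn nm; rewrite -(ltr_pM2l (x := 1 - q)) ?subr_gt0 //.
  apply: le_lt_trans (NE n Nn); have := tail n (m - n)%N; rewrite subnKC //.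
  by have := exprn_ge0 m q0; lra.
have [l lE] := cnorm_complete s sC; exists l.
apply/eqP; rewrite -subr_eq0; apply/eqP/cnorm0_eq0/le_anti; rewrite cnorm_ge0 andbT.
apply/ler_addgt0Pr => e e0; rewrite add0r.
pose M := cnorm (1 - b).
have M0 : 0 <= M by exact: cnorm_ge0.
have [|N1 N1E] := lE (e / 2 / (1 + M)); first by rewrite !divr_gt0 // ltr_wpDr.
have [|N2 N2E] := qsmall (e / 2); first by rewrite divr_gt0.
set N := maxn N1 N2.
have {}N1E := N1E N (leq_maxl _ _); have {}N2E := N2E N (leq_maxr _ _).
have -> : (1 - b) * l - 1 = - ((1 - b) * (s N - l) + b ^+ N).
  have : (1 - b) * s N = 1 - b ^+ N.
    by rewrite -[1 - b]opprB mulNr -subrX1 opprB.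
  by rewrite mulrBr => ->; rewrite addrAC subrK opprB.
rewrite cnormN; apply: le_trans (ler_cnormD _ _) _.
rewrite [leRHS]splitr lerD //; last first.
  by apply: le_trans (cnormX_le _ _) (ltW N2E).
apply: le_trans (ler_cnormM _ _) _; rewrite -/M.
apply: (@le_trans _ _ (M * (e / 2 / (1 + M)))); first by rewrite ler_wpM2l // ltW.
rewrite mulrA ler_pdivrMr ?ltr_wpDr // mulrC ler_wpM2l ?divr_ge0 ?ltW //.
by rewrite ltrDr.
Qed.

End Neumann.

Section Continuity.
Variables (R : realType) (A : cstarAlgType R) (n : nat).
Local Notation C := R[i].
Implicit Types phi psi : starHom A 'M[C]_n.+1.

(** If |c| > |a|, then 1 - c^-1 a is right invertible, hence so is its image,
    which kills no eigenvector. *)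
Lemma eigenvalue_starhom_le phi a (c : C) :
  eigenvalue (phi a) c -> absc c <= cnorm a.
Proof.
move=> /eigenvalueP[v vE v0]; rewrite leNgt; apply/negP => ac.
have c0 : c != 0.
  by apply: contraTneq ac => ->; rewrite absc0 ltNge cnorm_ge0.
have [|d dE] := @neumann_right_inverse R A (c^-1 *: a).
  rewrite cnormZ -/(absc _) -(ltr_pM2l (x := absc c)); last first.
    by apply: le_lt_trans (cnorm_ge0 a) ac.
  by rewrite mulrA -abscM divff // /absc normr1 mul1r mulr1.
have /(congr1 (mulmx v)) : phi (1 - c^-1 *: a) *m phi d = 1%:M.
  by have := congr1 phi dE; rewrite rmorphM rmorph1.
rewrite mulmx1 mulmxA rmorphB rmorph1 /= linearZ /= mulmxBr mulmx1 -scalemxAr vE.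
rewrite scalerA mulVf // scale1r subrr mul0mx => E.
by rewrite -E eqxx in v0.
Qed.

Lemma trace_eigenvalues (M : 'M[C]_n.+1) (c : R) :
  (forall x, eigenvalue M x -> absc x <= c) -> absc (\tr M) <= n.+1%:R * c.
Proof.
move=> Mc; have [rs E] := closed_field_poly_normal (char_poly M).
have lc : lead_coef (char_poly M) = 1 by apply/monicP; exact: char_poly_monic.
rewrite lc scale1r in E.
have srs : size rs = n.+1.
  by apply/eqP; rewrite -eqSS -(size_prod_XsubC rs id) -E size_char_poly.
have trE : \tr M = \sum_(r <- rs) r.
  apply: oppr_inj; rewrite -char_poly_trace // E -[in LHS]srs coefPn_prod_XsubC //.
  by rewrite srs.
have : forall r, r \in rs -> absc r <= c.
  by move=> r rrs; apply: Mc; rewrite eigenvalue_root_char E root_prod_XsubC.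
rewrite trE -srs; elim: rs {E srs trE} => [|r rs IH] rsc.
  by rewrite big_nil absc0 mul0r.
rewrite big_cons (le_trans (abscD _ _)) //= -addn1 natrD mulrDl mul1r addrC lerD //.
  by apply: IH => x xrs; apply: rsc; rewrite inE xrs orbT.
by apply: rsc; rewrite inE eqxx.
Qed.

(** Automatic continuity, without functional calculus: the trace of
    phi(a)^* phi(a) = phi(a^* a) is the sum of the squared moduli of the entries
    of phi(a), and as a sum of eigenvalues it is at most n |a^* a| = n |a|^2. *)
Lemma starhom_entry_le phi a i j : absc (phi a i j) <= n.+1%:R * cnorm a.
Proof.
have n1 : 1 <= n.+1%:R :> R by rewrite ler1n.
rewrite -ler_sqr ?nnegrE ?absc_ge0 ?mulr_ge0 ?cnorm_ge0 //.
apply: (@le_trans _ _ (n.+1%:R * cnorm (star a * a))); last first.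
  rewrite cnorm_star exprMn ler_wpM2r ?exprn_ge0 ?cnorm_ge0 //.
  by rewrite expr2 ler_peMr.
apply: le_trans (@trace_eigenvalues (phi (star a * a)) _ _); last first.
  by move=> x; exact: eigenvalue_starhom_le.
have trE : \tr (phi (star a * a)) = (\sum_k \sum_l absc (phi a k l) ^+ 2)%:C.
  rewrite rmorphM /= morph_star exchange_big rmorph_sum; apply: eq_bigr => k _.
  rewrite mxE rmorph_sum; apply: eq_bigr => l _.
  by rewrite !mxE mulrC rmorphXn /= absc_norm; symmetry; exact: normCK.
rewrite -lecR absc_norm trE normc_def /= expr0n addr0 sqrtr_sqr lecR.
apply: le_trans (ler_norm _); rewrite (bigD1 i) //= (bigD1 j) //= -addrA lerDl.
by rewrite addr_ge0 ?sumr_ge0 // => k _; rewrite ?sumr_ge0 // => *; rewrite exprn_ge0 ?absc_ge0.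
Qed.

(** By continuity, the set where two morphisms to matrices agree is a closed
    *-subalgebra. *)
Lemma starhom_eq m (u : 'M[A]_m) phi psi : entries_generate u ->
  (forall i j, phi (u i j) = psi (u i j)) -> forall a, phi a = psi a.
Proof.
move=> gu uE; suff : [set a | phi a = psi a] = setT.
  by move=> E a; have : [set a | phi a = psi a] a by rewrite E.
apply: gu => //; split=> [a aB| |c a b /= aE bE|a b /= aE bE|a /= aE]; last first.
- by rewrite /= !morph_star; congr star.
- by rewrite !rmorphM /=; congr (_ * _).
- by rewrite !linearP /=; congr (_ *: _ + _).
- by rewrite /= !rmorph1.
apply/matrixP => i j; apply/eqP; rewrite -subr_eq0; apply/eqP/absc_eq0/le_anti.
rewrite absc_ge0 andbT; apply/ler_addgt0Pr => e e0; rewrite add0r.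
have [|b /= bE ab] := aB (e / (2 * n.+1%:R)); first by rewrite divr_gt0 ?mulr_gt0.
have -> : phi a i j - psi a i j = phi (a - b) i j + - psi (a - b) i j.
  by rewrite !rmorphB /= bE !mxE; ring.
have absN z : absc (- z) = absc z :> R by rewrite /absc normrN.
apply: le_trans (abscD _ _) _; rewrite absN.
apply: le_trans (lerD (starhom_entry_le _ _ _ _) (starhom_entry_le _ _ _ _)) _.
move/ltW: ab; rewrite ler_pdivlMr ?mulr_gt0 // => ab.
by rewrite (_ : _ + _ = cnorm (a - b) * (2 * n.+1%:R)) //; ring.
Qed.

End Continuity.

(** * Factorization through functions on the symmetric group *)

Section Composition.
Variables (R : realType) (A B D : starAlgType R).
Variables (f : starHom A B) (g : starHom B D).

Let comp_star : {morph g \o f : a / star a >-> star a}.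
Proof. by move=> a; rewrite /= !morph_star. Qed.

HB.instance Definition _ := isStarMorphism.Build R A D (g \o f) comp_star.

Lemma starhom_comp : exists k : starHom A D, forall a, k a = g (f a).
Proof. by exists (g \o f). Qed.

End Composition.

Section Atomic.
Variables (R : realType) (B : starAlgType R) (n : nat) (P : 'M[B]_n.+1).
Hypothesis magicP : magic_unitary P.
Hypothesis atomicP : forall i j i' j', P i j * P i' j' = 0 \/ P i j = P i' j'.
Hypothesis neq0P : forall i j, P i j != 0.

Let row_orth i j l : j != l -> P i j * P i l = 0.
Proof. by have [_ o _] := magicP.1 i; exact: o. Qed.

Let col_orth i l j : i != l -> P i j * P l j = 0.
Proof. by have [_ o _] := magicP.2 j; exact: o. Qed.

Let idem i j : P i j * P i j = P i j.
Proof. by have [p _ _] := magicP.1 i; exact: (p j).1. Qed.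

(** The row i sums to 1, so some P_ij has a nonzero product with P_0k, and by
    atomicity equals it; the orthogonality of the columns makes i |-> j injective.
    In other words every row lists the same projections, in another order. *)
Lemma atomic_magic_perm :
  exists s : 'I_n.+1 -> {perm 'I_n.+1}, forall k i, P i (s k i) = P 0 k.
Proof.
have ex k i : exists j, P i j = P 0 k.
  have [//|no] := pselect (exists j, P i j = P 0 k).
  have [_ _ sum1] := magicP.1 i; have := neq0P 0 k.
  rewrite -[P 0 k]mul1r -sum1 mulr_suml big1 ?eqxx // => j _.
  by have [//|e] := atomicP i j 0 k; case: no; exists j.
have /choice[s0 s0E] k : exists f : 'I_n.+1 -> 'I_n.+1, forall i, P i (f i) = P 0 k.
  by have /choice[f fE] := ex k; exists f.
have s0I k : injective (s0 k).
  move=> i l E; apply/eqP; apply: contraT => /(col_orth (s0 k i)).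
  rewrite [in X in _ * X = _ -> _]E !s0E idem => /eqP.
  by rewrite (negbTE (neq0P 0 k)).
by exists (fun k => perm (@s0I k)) => k i; rewrite permE.
Qed.

(** In f |-> sum_k f(s_k) P_0k, the permutation s_k records the position of P_0k in
    each row.  The coordinate (i, j) goes to the sum of the P_0k with s_k(i) = j;
    these are the P_0k with nonzero product P_ij P_0k, and they sum to P_ij. *)
Lemma atomic_magic_hom : exists g : starHom (fun_alg R {perm 'I_n.+1}) B,
  forall i j, g (perm_coord R n.+1 i j) = P i j.
Proof.
have [s sE] := atomic_magic_perm.
have [g gE] := spectral_hom_exists s (magicP.1 0).
exists g => i j; rewrite gE; have [_ _ sum1] := magicP.1 0.
rewrite -[RHS]mulr1 -sum1 mulr_sumr; apply: eq_bigr => k _.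
rewrite perm_coordE -(sE k i); case: eqVneq => [->|kj].
  by rewrite scale1r idem.
by rewrite scale0r row_orth // eq_sym.
Qed.

End Atomic.

Section HadamardProjections.
Variables (R : realType) (n : nat).
Local Notation C := R[i].
Variable h : 'M[C]_n.+1.
Hypothesis h1 : unimodular h.

Lemma hadamard_projection_neq0 i j : hadamard_projection h i j != 0.
Proof.
rewrite /hadamard_projection line_projectionE => [|a]; last exact: row_ratio_unimod.
apply/eqP => /matrixP/(_ 0 0)/eqP; rewrite !mxE mulf_eq0 invr_eq0 pnatr_eq0 /=.
rewrite mulf_eq0 conjC_eq0 orbb (negbTE (unimod_neq0 _)) //.
exact: row_ratio_unimod.
Qed.

Lemma hadamard_projection_atomic : ratio_dichotomy h -> forall i j i' j',
  hadamard_projection h i j * hadamard_projection h i' j' = 0 \/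
  hadamard_projection h i j = hadamard_projection h i' j'.
Proof.
move=> Q i j i' j'; have r1 i j a := row_ratio_unimod i j a h1.
rewrite /hadamard_projection -!/(row_ratio _ _ _).
case: (Q i j i' j') => [[c c1 cE]|o]; [right|left].
  rewrite !line_projectionE //; congr (_ *: _); apply/matrixP => a b.
  rewrite !mxE !cE rmorphM /= -[RHS]mul1r -(mulcJ1 c1); ring.
rewrite line_projectionM // o rmorph0 mulr0.
by apply/matrixP => a b; rewrite !mxE mul0r.
Qed.

End HadamardProjections.

Lemma starhom_magic (R : realType) (A B : starAlgType R) n (f : starHom A B)
    (u : 'M[A]_n) (v : 'M[B]_n) :
  (forall i j, f (u i j) = v i j) -> magic_unitary u -> magic_unitary v.
Proof.
move=> fE [ur uc].
have fP (p : 'I_n -> A) (q : 'I_n -> B) : (forall k, f (p k) = q k) ->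
    partition_of_unity p -> partition_of_unity q.
  move=> pq [pp po p1]; split=> [k|k l kl|].
  - by rewrite -pq; split; [rewrite -rmorphM (pp k).1|rewrite -morph_star (pp k).2].
  - by rewrite -!pq -rmorphM po // rmorph0.
  - by under eq_bigr do rewrite -pq; rewrite -rmorph_sum p1 rmorph1.
by split=> i; [apply: fP (ur i) => k|apply: fP (uc i) => k]; rewrite fE.
Qed.

Theorem theorem5p1 (R : realType) (n : nat) (h : 'M[R[i]]_n.+1)
    (A : cstarAlgType R) (u : 'M[A]_n.+1) :
  hadamard h -> hadamard_algebra h u ->
  ((forall a b : A, a * b = b * a) <->
   (exists k : 'M[R[i]]_n.+1, fourier_tensor k /\ hadamard_equiv h k)).
Proof.
move=> hh [AS [x [pi [[magx genx univx] piE [_ [f [g [fE gE]]] minu]]]]].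
split=> [comA|[k [tk hk]]].
  apply: hadamard_dichotomy_fourier => //.
  apply: (comm_hadamard_projection hh.1) => i j i' j'.
  by rewrite -!piE !gE !fE -!rmorphM; congr (g _); exact: comA.
have Q : ratio_dichotomy h.
  apply: ratio_dichotomy_equiv (hadamard_equiv_sym hk) _.
  exact: ratio_dichotomy_fourier_tensor.
pose P := \matrix_(i, j) hadamard_projection h i j.
have magP : magic_unitary P.
  by apply: (starhom_magic (f := pi) _ magx) => i j; rewrite piE mxE.
have [||g' g'E] := atomic_magic_hom magP.
- by move=> i j i' j'; rewrite !mxE; apply: hadamard_projection_atomic hh.1 Q _ _ _ _.
- by move=> i j; rewrite mxE; apply: hadamard_projection_neq0 hh.1 _ _.
have [f' f'E] := univx _ _ (perm_coord_magic R n.+1).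
have facx : factors_through x pi (perm_coord R n.+1).
  exists f', g'; split=> // a; have [k' k'E] := starhom_comp f' g'.
  rewrite -k'E; apply: (starhom_eq genx) => i j.
  by rewrite k'E f'E g'E mxE piE.
have [F [Fsurj _]] := minu _ _ (perm_coord_qpa R n.+1) facx.
move=> a b; have [a' <-] := Fsurj a; have [b' <-] := Fsurj b.
by rewrite -!rmorphM; congr (F _); exact: fun_algC.
Qed.
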